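(* For the metaplectic spinors on $\mathbb CP^1=SU(2)/U(1)$, $$P=-\Omega-\tfrac32H^2,$$ and $$[P,\mathscr D]=-3\mathscr DH-\tfrac32\mathscr D,\qquad[P,\bar{\mathscr D}]=3\bar{\mathscr D}H-\tfrac32\bar{\mathscr D}.$$
   Context: $G=SU(2)$, $T=U(1)$ the diagonal torus with Lie algebra $\mathfrak t$, $\alpha$ the positive root. $g_0$ is minus the Killing form, and $\{E,F\}$ is a $g_0$-orthonormal basis of $\mathfrak t^\perp$ such that $Z=\frac12(E-iF)$, $\bar Z=\frac12(E+iF)$ are root vectors for $\alpha$ and $-\alpha$. $JE=F$, $JF=-E$ and $\omega_0(X,Y)=g_0(JX,Y)$ define the ($SU(2)$-invariant, Kähler) structure on $\mathbb CP^1=G/T$. Canonical quantization: $\sigma(E)=ix$, $\sigma(F)=d/dx$ on functions on $\mathbb R$, extended complex-linearly. $E_l^0$ is the line spanned by the Hermite function $h_l(x)=e^{x^2/2}\frac{d^l}{dx^l}e^{-x^2}$. $T$ acts on $E_l^0$, through the metaplectic representation composed with the lift of the adjoint action to the double cover of $U(\mathfrak t^\perp)$, with weight $(2l+1)\varpi$, where $\varpi=\alpha/2$ is the fundamental weight. The metaplectic spinor bundle is $S_m=\bigoplus_{l\ge0}E_l$ with $E_l=G\times_TE_l^0$; sections of $E_l$ are smooth $\phi:G\to E_l^0$ with $\phi(gt)=t^{-1}\cdot\phi(g)$ for $t\in T$. $H=\frac12(\sigma(E)^2+\sigma(F)^2)$ acts on $E_l$ as $-(l+\frac12)$. The symplectic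 Dolbeault operators are $\mathscr D\phi=4i\,\sigma(\bar Z)\,Z\cdot\phi:\Gamma(E_l)\to\Gamma(E_{l-1})$ and $\bar{\mathscr D}\phi=-4i\,\sigma(Z)\,\bar Z\cdot\phi:\Gamma(E_l)\to\Gamma(E_{l+1})$, where $X\cdot\phi$ is differentiation along the left-invariant vector field $X$ (extended complex-linearly); $P=\frac12[\mathscr D,\bar{\mathscr D}]$. $\Omega$ is the Casimir element of $\mathfrak{su}(2)$ with respect to $g_0$ (the sum of squares of a $g_0$-orthonormal basis), acting by left-invariant differentiation; explicitly $\Omega=-\frac18h^2-\frac14(XY+YX)$ for the standard basis $h,X,Y$ of $\mathfrak{sl}(2,\mathbb C)$. *)

(* Defs.v *)
From HB Require Import structures.
From mathcomp Require Import all_boot all_order all_algebra.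
From mathcomp Require Import complex.
From mathcomp Require Import all_classical all_reals all_analysis.
From mathcomp Require Import ring lra.

Set Implicit Arguments.
Unset Strict Implicit.
Unset Printing Implicit Defensive.

Import Order.TTheory GRing.Theory Num.Theory.
Import numFieldNormedType.Exports.

Local Open Scope classical_set_scope.
Local Open Scope sesquilinear_scope.
Local Open Scope complex_scope.
Local Open Scope ring_scope.

Section SU2.
Variable R : realType.
Local Notation C := R[i].
Local Notation M2 := 'M[C]_2.

Definition inSU2 : pred M2 := fun g => (g \is unitarymx) && (\det g == 1).

Record SU2 := MkSU2 { SU2_mx :> M2; SU2_mxP : inSU2 SU2_mx }.

HB.instance Definition _ := [isSub for SU2_mx].
HB.instance Definition _ := [Choice of SU2 by <:].

Fact SU2_one_subproof : inSU2 1.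
Proof. by rewrite /inSU2 det1 eqxx andbT; apply/unitarymxP; rewrite trmx1 map_mx1 mulmx1. Qed.

Fact SU2_mul_subproof (g h : SU2) : inSU2 (SU2_mx g *m SU2_mx h).
Proof.
have /andP[gU /eqP g1] := SU2_mxP g; have /andP[hU /eqP h1] := SU2_mxP h.
by rewrite /inSU2 mul_unitarymx//= det_mulmx g1 h1 mulr1.
Qed.

Fact SU2_inv_subproof (g : SU2) : inSU2 ((SU2_mx g)^t*).
Proof.
have /andP[gU /eqP g1] := SU2_mxP g; rewrite /inSU2 trmxC_unitary gU /=.
by rewrite det_map_mx det_tr g1 rmorph1.
Qed.

Definition SU2_one := MkSU2 SU2_one_subproof.
Definition SU2_mul g h := MkSU2 (SU2_mul_subproof g h).
Definition SU2_inv g := MkSU2 (SU2_inv_subproof g).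

Fact SU2_mulA : associative SU2_mul.
Proof. by move=> g h k; apply: val_inj; rewrite /= mulmxA. Qed.

Fact SU2_mul1 : left_id SU2_one SU2_mul.
Proof. by move=> g; apply: val_inj; rewrite /= mul1mx. Qed.

Fact SU2_mulr1 : right_id SU2_one SU2_mul.
Proof. by move=> g; apply: val_inj; rewrite /= mulmx1. Qed.

Fact SU2_mulrV : right_inverse SU2_one SU2_inv SU2_mul.
Proof.
by move=> [g gP]; apply: val_inj => /=; apply/unitarymxP; case/andP: gP.
Qed.

Fact SU2_mulV : left_inverse SU2_one SU2_inv SU2_mul.
Proof.
move=> g; apply: val_inj => /=; apply: mulmx1C.
exact: (congr1 val (SU2_mulrV g)).
Qed.

HB.instance Definition _ := isGroup.Build SU2
  SU2_mulA SU2_mul1 SU2_mulr1 SU2_mulV SU2_mulrV.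

Definition su2 : pred M2 := fun A => (A^t* == - A) && (\tr A == 0).

(* C is given no topology here: limits and derivatives of C-valued functions are
   taken on real and imaginary parts. *)
Definition clim (u : nat -> C) : C :=
  limn (fun n => complex.Re (u n)) +i* limn (fun n => complex.Im (u n)).

Definition expm (A : M2) : M2 :=
  \matrix_(i, j) clim (fun n => (\sum_(k < n) (k`!%:R)^-1 *: A ^+ k) i j).

Lemma conjC_conjc (z : C) : (z^*)%R = conjc z. Proof. by []. Qed.

Lemma ord2P (k : 'I_2) : k = 0 \/ k = 1.
Proof. by case: k => [[|[|//]]] ?; [left|right]; apply: val_inj. Qed.

Lemma matrix2P (A B : M2) :
  A 0 0 = B 0 0 -> A 0 1 = B 0 1 -> A 1 0 = B 1 0 -> A 1 1 = B 1 1 -> A = B.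
Proof.
move=> ? ? ? ?; apply/matrixP => i j.
by case: (ord2P i) => ->; case: (ord2P j) => ->.
Qed.

Lemma sum2E (V : nmodType) (F : 'I_2 -> V) : \sum_i F i = F 0 + F 1.
Proof.
rewrite !big_ord_recl big_ord0 addr0; congr (_ + F _); exact: val_inj.
Qed.

Lemma det2E (A : M2) : \det A = A 0 0 * A 1 1 - A 0 1 * A 1 0.
Proof.
rewrite (expand_det_row _ 0) sum2E /cofactor !det_mx11 !mxE /=.
rewrite expr0 expr1 mul1r mulN1r mulrN.
by congr (A _ _ * A _ _ - A _ _ * A _ _); apply: val_inj.
Qed.

Lemma su2Z (t : R) A : su2 A -> su2 (t%:C *: A).
Proof.
move=> /andP[/eqP hA /eqP tA]; apply/andP; split; last by rewrite mxtraceZ tA mulr0.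
apply/eqP/matrixP => i j; move/matrixP/(_ i j): hA; rewrite !mxE => hA.
by rewrite rmorphM /= [X in _ * X]hA conjC_conjc conjc_real mulrN.
Qed.

Lemma su2_tr A : su2 A -> A 1 1 = - A 0 0.
Proof.
by move=> /andP[_]; rewrite /mxtrace sum2E addrC addr_eq0 => /eqP.
Qed.

Lemma su2_conj A i j : su2 A -> conjc (A j i) = - A i j.
Proof.
by move=> /andP[/eqP/matrixP/(_ i j) + _]; rewrite !mxE.
Qed.

Lemma su2_det A : su2 A ->
  exists2 th : R, \det A = (th ^+ 2)%:C & th = 0 -> A = 0.
Proof.
move=> sA; have tA := su2_tr sA.
have [a a0] : exists a, A 0 0 = 0 +i* a.
  have := su2_conj 0 0 sA; case: (A 0 0) => x y [/eqP].
  by rewrite -subr_eq0 opprK -mulr2n mulrn_eq0 /= => /eqP ->; exists y.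
have e10 : A 1 0 = - conjc (A 0 1) by rewrite su2_conj// opprK.
case E01 : (A 0 1) => [x y].
exists (Num.sqrt (a ^+ 2 + (x ^+ 2 + y ^+ 2))).
  rewrite sqr_sqrtr ?addr_ge0 ?sqr_ge0//.
  rewrite det2E tA e10 a0 E01; simpc; congr (_ +i* _); ring.
move/eqP; rewrite sqrtr_eq0 => h.
have [/eqP x0 /eqP y0 /eqP a0'] : [/\ x == 0, y == 0 & a == 0].
  by split; rewrite -sqrf_eq0; apply/eqP; nra.
have z : (0 : C) = 0 +i* 0 by [].
by apply: matrix2P; rewrite !mxE ?tA ?e10 ?a0 ?E01 ?x0 ?y0 ?a0' z; simpc.
Qed.

Lemma su2_sqr A : su2 A -> A *m A = - \det A *: 1%:M.
Proof.
move=> sA; rewrite det2E; apply: matrix2P;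
  rewrite !mxE sum2E (su2_tr sA) /= ?mulr1n ?mulr0n; ring.
Qed.

Lemma su2_exp_term A (th : R) k : su2 A -> \det A = (th ^+ 2)%:C ->
  (th = 0 -> A = 0) ->
  (k`!%:R : C)^-1 *: A ^+ k =
  (cos_coeff th k)%:C *: 1 + (sin_coeff th k / th)%:C *: A.
Proof.
move=> sA dA th0.
have A2 : A ^+ 2 = - (th ^+ 2)%:C *: 1 by rewrite expr2 -dA -su2_sqr.
have fE : (k`!%:R : C)^-1 = (k`!%:R^-1)%:C by rewrite fmorphV rmorph_nat.
rewrite -[in A ^+ k](odd_double_half k) -mul2n exprD exprM A2 fE.
rewrite /cos_coeff /sin_coeff /= exprZn expr1n -scalerAr mulr1 scalerA.
rewrite -rmorphN -rmorphXn -rmorphM.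
have exprNn' : (- th ^+ 2) ^+ k./2 = (-1) ^+ k./2 * (th ^+ 2) ^+ k./2.
  exact: exprNn.
case: (boolP (odd k)) => o.
  rewrite expr1 /= !mul0r scale0r add0r.
  have [z|tn0] := eqVneq th 0; first by rewrite th0// !scaler0.
  congr (_%:C *: _).
  have tk : th ^+ k = th * (th ^+ 2) ^+ k./2.
    by rewrite -exprM mul2n -exprS; congr (_ ^+ _); rewrite -[LHS]odd_double_half o.
  have kk : (k.-1./2 = k./2)%N by rewrite -[in LHS](odd_double_half k) o /= doubleK.
  rewrite kk exprNn' tk; field.
  by rewrite tn0 pnatr_eq0 -lt0n fact_gt0.
have -> : A ^+ false = 1 by [].
rewrite /= !mul0r scale0r addr0; congr (_%:C *: _).
have tk : th ^+ k = (th ^+ 2) ^+ k./2.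
  by rewrite -exprM mul2n; congr (_ ^+ _); rewrite -[LHS]odd_double_half (negbTE o).
by rewrite exprNn' tk mul1r mulrC.
Qed.

Lemma expm_su2 A : su2 A -> exists c s : R,
  expm A = c%:C *: 1 + s%:C *: A /\ (c ^+ 2)%:C + (s ^+ 2)%:C * \det A = 1.
Proof.
move=> sA; have [th dA th0] := su2_det sA.
exists (cos th), (sin th / th); split; last first.
  rewrite dA -rmorphM -rmorphD -exprMn.
  have -> : sin th / th * th = sin th.
    by have [->|h] := eqVneq th 0; rewrite ?sin0 ?mul0r ?divfK.
  by rewrite cos2Dsin2.
have partial n i j : (\sum_(k < n) (k`!%:R : C)^-1 *: A ^+ k) i j =
   (series (cos_coeff th) n)%:C * (1 : M2) i j +
   (series (sin_coeff th) n / th)%:C * A i j.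
  rewrite /series /= !big_mkord mulr_suml !rmorph_sum !mulr_suml -big_split /=.
  rewrite summxE; apply: eq_bigr => k _.
  by rewrite (su2_exp_term _ sA dA th0) !mxE.
have rhsE i j : ((cos th)%:C *: 1 + (sin th / th)%:C *: A) i j =
    (cos th)%:C * (1 : M2) i j + (sin th / th)%:C * A i j by rewrite !mxE.
apply/matrixP => i j; rewrite rhsE mxE /clim.
have ReM (x : R) (z : C) : complex.Re (x%:C * z) = x * complex.Re z.
  by case: z => u v; simpc.
have ImM (x : R) (z : C) : complex.Im (x%:C * z) = x * complex.Im z.
  by case: z => u v; simpc.
have cc : series (cos_coeff th) n @[n --> \oo] --> cos th.
  by rewrite unlock; exact: is_cvg_series_cos_coeff.
have cs : series (sin_coeff th) n @[n --> \oo] --> sin th.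
  by rewrite unlock; exact: is_cvg_series_sin_coeff.
have key (u : nat -> R) (p q : R) :
    (forall n, u n = series (cos_coeff th) n * p + series (sin_coeff th) n / th * q) ->
    limn u = cos th * p + sin th / th * q.
  move=> /funext ->; apply: cvg_lim => //.
  by apply: cvgD; [exact: cvgMl|apply: cvgMl; exact: cvgMl].
apply/eqP; rewrite eq_complex; apply/andP; split; apply/eqP.
- by rewrite raddfD /= !ReM; apply: key => n; rewrite partial raddfD /= !ReM.
- by rewrite raddfD /= !ImM; apply: key => n; rewrite partial raddfD /= !ImM.
Qed.

Lemma expm_SU2 A : su2 A -> inSU2 (expm A).
Proof.
move=> sA; have [c [s [-> e]]] := expm_su2 sA.
have /andP[/eqP hA _] := sA.
apply/andP; split.
  apply/unitarymxP.
  have -> : (c%:C *: 1 + s%:C *: A)^t* = c%:C *: 1 - s%:C *: A.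
    apply/matrixP => i j; rewrite !mxE rmorphD !rmorphM /= !conjC_conjc.
    by rewrite su2_conj// !conjc_real conjc_nat mulrN eq_sym.
  rewrite mulmxDl !mulmxBr -!scalemxAl -!scalemxAr !mul1mx !mulmx1 su2_sqr//.
  rewrite !scalerA mulrN scaleNr opprK addrA.
  rewrite [_%:C * s%:C]mulrC subrK -!rmorphM -!expr2.
  by rewrite -scalerDl e scale1r.
apply/eqP; rewrite -e det2E !mxE /= (su2_tr sA) det2E (su2_tr sA) !rmorphXn /=; ring.
Qed.

(* The default value 1 of [insubd] is never used on su(2), by [val_expSU2]. *)
Definition expSU2 (A : M2) : SU2 := insubd (1%g : SU2) (expm A).

Lemma val_expSU2 A : su2 A -> SU2_mx (expSU2 A) = expm A.
Proof. by move=> sA; rewrite -[SU2_mx]/val val_insubd expm_SU2. Qed.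

End SU2.

Section LieAlgebra.
Variable R : realType.
Local Notation C := R[i].
Local Notation M2 := 'M[C]_2.
Implicit Types A B E F Z W : M2.

Definition bracket A B : M2 := A *m B - B *m A.

Definition sl2_h : M2 := delta_mx 0 0 - delta_mx 1 1.
Definition sl2_X : M2 := delta_mx 0 1.
Definition sl2_Y : M2 := delta_mx 1 0.

(* The trace of ad A \o ad B on sl(2,C), computed in the basis h, X, Y, whose
   dual coordinates on sl(2,C) are the entries (0,0), (0,1) and (1,0).  On
   su(2) it restricts to the Killing form of su(2), as sl(2,C) is the
   complexification of su(2). *)
Definition killing A B : C :=
  let adAB W := bracket A (bracket B W) in
  adAB sl2_h 0 0 + adAB sl2_X 0 1 + adAB sl2_Y 1 0.

Lemma bracketE A B i j : bracket A B i j =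
  A i 0 * B 0 j + A i 1 * B 1 j - (B i 0 * A 0 j + B i 1 * A 1 j).
Proof. by rewrite /bracket !mxE !sum2E. Qed.

Lemma killing_tr A B : A 1 1 = - A 0 0 -> B 1 1 = - B 0 0 ->
  killing A B = 4 * \tr (A *m B).
Proof.
move=> hA hB.
have main (h X Y : M2) :
    h 0 0 = 1 -> h 0 1 = 0 -> h 1 0 = 0 -> h 1 1 = -1 ->
    X 0 0 = 0 -> X 0 1 = 1 -> X 1 0 = 0 -> X 1 1 = 0 ->
    Y 0 0 = 0 -> Y 0 1 = 0 -> Y 1 0 = 1 -> Y 1 1 = 0 ->
  bracket A (bracket B h) 0 0 + bracket A (bracket B X) 0 1 +
  bracket A (bracket B Y) 1 0 = 4 * \tr (A *m B).
  move=> h1 h2 h3 h4 X1 X2 X3 X4 Y1 Y2 Y3 Y4.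
  rewrite !bracketE h1 h2 h3 h4 X1 X2 X3 X4 Y1 Y2 Y3 Y4.
  rewrite /mxtrace sum2E !mxE !sum2E hA hB.
  move: (A 0 0) (A 0 1) (A 1 0) (B 0 0) (B 0 1) (B 1 0) => a b c d e f.
  ring.
by apply: main; rewrite !mxE /= ?subr0 ?sub0r.
Qed.

(* Minus the Killing form, extended complex-bilinearly. *)
Definition g0 A B : C := - killing A B.

(* The Lie algebra of the diagonal torus T. *)
Definition lie_torus : pred M2 := fun A => su2 A && is_diag_mx A.

Definition alpha A : C := A 0 0 - A 1 1.

Definition root_vector (beta : M2 -> C) Z : Prop :=
  Z != 0 /\ forall A, lie_torus A -> bracket A Z = beta A *: Z.

Definition vZ E F : M2 := 2^-1 *: (E - 'i%C *: F).
Definition vZbar E F : M2 := 2^-1 *: (E + 'i%C *: F).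

Record adapted_frame E F : Prop := AdaptedFrame {
  frame_su2E : su2 E;
  frame_su2F : su2 F;
  frame_perpE : forall A, lie_torus A -> g0 A E = 0;
  frame_perpF : forall A, lie_torus A -> g0 A F = 0;
  frame_EE : g0 E E = 1;
  frame_FF : g0 F F = 1;
  frame_EF : g0 E F = 0;
  frame_Z : root_vector alpha (vZ E F);
  frame_Zbar : root_vector (fun A => - alpha A) (vZbar E F)
}.

(* An orthonormal family of three vectors is a basis, since dim su(2) = 3. *)
Definition su2_onb (e : 'I_3 -> M2) : Prop :=
  (forall k, su2 (e k)) /\ (forall j k, g0 (e j) (e k) = (j == k)%:R).

End LieAlgebra.

Section Smooth.
Variables (R : realType) (V W : normedModType R).

(* f is of class C^k on the open set U. *)
Fixpoint smooth_upto (k : nat) (U : set V) (f : V -> W) : Prop :=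
  if k is k'.+1 then
    (forall x, U x -> differentiable f x) /\
    (forall v, smooth_upto k' U (fun x => 'D_v f x))
  else forall x, U x -> {for x, continuous f}.

Definition smooth_on (U : set V) (f : V -> W) := forall k, smooth_upto k U f.

End Smooth.

Section Spinors.
Variable R : realType.
Local Notation C := R[i].
Local Notation M2 := 'M[C]_2.
Local Notation G := (SU2 R).

Definition reim (g : G) : 'M[R]_2 * 'M[R]_2 :=
  (map_mx (@complex.Re R) (SU2_mx g), map_mx (@complex.Im R) (SU2_mx g)).

(* SU(2) is a submanifold of the real vector space of 2 x 2 complex matrices:
   a function on it is smooth when it extends smoothly near every point. *)
Definition smooth_SU2 (c : G -> C) : Prop :=
  forall g : G, exists (U : set ('M[R]_2 * 'M[R]_2))
                       (a b : 'M[R]_2 * 'M[R]_2 -> R),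
    [/\ open U /\ U (reim g), smooth_on U a, smooth_on U b &
        forall h : G, U (reim h) -> c h = a (reim h) +i* b (reim h)].

Definition Cderive (f : R -> C) (x : R) : C :=
  derive1 (@complex.Re R \o f) x +i* derive1 (@complex.Im R \o f) x.

(* Maps from G to functions on the real line. *)
Definition spinor := G -> R -> C.

(* Left-invariant derivative along A in su(2). *)
Definition left_der (A : M2) (phi : spinor) : spinor := fun g x =>
  Cderive (fun t : R => phi (g * expSU2 (t%:C *: A))%g x) 0.

(* Complex-linear extension to sl(2,C): W = A + iB with A and B in su(2). *)
Definition lder (W : M2) (phi : spinor) : spinor := fun g x =>
  left_der (2^-1 *: (W - W^t* )) phi g x +
  'i%C * left_der ((2 * 'i%C)^-1 *: (W + W^t* )) phi g x.

Definition casimir (e : 'I_3 -> M2) (phi : spinor) : spinor :=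
  \sum_(k < 3) left_der (e k) (left_der (e k) phi).

(* Complex-linear in W, with sigma(E) = ix and sigma(F) = d/dx: the
   coordinates of W in the orthonormal basis (E, F) are g0 W E and g0 W F. *)
Definition sigma (E F W : M2) (f : R -> C) : R -> C := fun x =>
  g0 W E * ('i%C * x%:C * f x) + g0 W F * Cderive f x.

Definition opH (E F : M2) (phi : spinor) : spinor := fun g =>
  2^-1 *: (sigma E F E (sigma E F E (phi g)) + sigma E F F (sigma E F F (phi g))).

Definition dolbeault (E F : M2) (phi : spinor) : spinor := fun g =>
  (4 * 'i%C) *: sigma E F (vZbar E F) (lder (vZ E F) phi g).

Definition dolbeault_bar (E F : M2) (phi : spinor) : spinor := fun g =>
  (- (4 * 'i%C)) *: sigma E F (vZ E F) (lder (vZbar E F) phi g).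

Definition commutator (S T : spinor -> spinor) (phi : spinor) : spinor :=
  S (T phi) - T (S phi).

Definition opP (E F : M2) (phi : spinor) : spinor :=
  2^-1 *: commutator (dolbeault E F) (dolbeault_bar E F) phi.

Definition hermite (l : nat) (x : R) : R :=
  expR (x ^+ 2 / 2) * derive1n l (fun y : R => expR (- y ^+ 2)) x.

Definition torus : pred G := fun t => is_diag_mx (SU2_mx t).

(* diag(z, z^-1) |-> z is the character of T with differential
   varpi = alpha / 2, so this is the action of weight (2 l + 1) varpi. *)
Definition torus_act (l : nat) (t : G) (f : R -> C) : R -> C :=
  (SU2_mx t 0 0) ^+ (2 * l + 1) *: f.

(* Sections of E_l, as T-equivariant smooth maps from G to the complex line
   spanned by the l-th Hermite function; c is the coordinate of phi. *)
Definition section_E (l : nat) (phi : spinor) : Prop :=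
  (exists2 c : G -> C, smooth_SU2 c &
     forall g, phi g = fun x => c g * (hermite l x)%:C) /\
  (forall g t, torus t -> phi (g * t)%g = torus_act l t^-1%g (phi g)).

(* Sections of the algebraic direct sum of the bundles E_l, l >= 0. *)
Definition section_Sm (phi : spinor) : Prop :=
  exists (n : nat) (psi : nat -> spinor),
    (forall l, section_E l (psi l)) /\ phi = \sum_(l < n) psi l.

End Spinors.

(* Main.v *)
From HB Require Import structures.
Require Import Defs.
From mathcomp Require Import all_boot all_order all_algebra.
From mathcomp Require Import complex.
From mathcomp Require Import all_classical all_reals all_analysis.
From mathcomp Require Import ring lra.

Set Implicit Arguments.
Unset Strict Implicit.
Unset Printing Implicit Defensive.

Import Order.TTheory GRing.Theory Num.Theory.
Import numFieldNormedType.Exports.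

Local Open Scope classical_set_scope.
Local Open Scope sesquilinear_scope.
Local Open Scope complex_scope.
Local Open Scope ring_scope.

(** Write a section of E_l as c h_l, with c a complex function on SU(2) and h_l
    the l-th Hermite function. The relations h_l' = x h_l + h_(l+1) and
    h_(l+1) = - 2 x h_l - 2 l h_(l-1) turn Clifford multiplication into the
    shifts sigma(Z) h_l = - (i/2) h_(l+1) and sigma(Zbar) h_l = - i l h_(l-1),
    so that, with a and b for the left-invariant derivatives along Z and Zbar,
<<
      D (c h_l) = 4 l (a c) h_(l-1),      Dbar (c h_l) = - 2 (b c) h_(l+1),
      P (c h_l) = (4 l b a c - 4 (l + 1) a b c) h_l.
>>
    Everything thus reduces to identities between differential operators on
    the coefficients c: see [dolbeault_spin], [dolbeault_bar_spin],
    [opH_spin] and [opP_spin].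

    The torus enters through K, the derivative along diag(i, -i).
    Equivariance gives K c = - (2 l + 1) i c ([section_weight]), and the Lie
    algebra gives [K, a] = 2 i a, [K, b] = - 2 i b and [a, b] = (i/8) K. On a
    function of weight w = 2 l + 1 the last relation reads a b = b a + w/8, and
    the derivatives a and b change w by -2 and +2. Since the Casimir element is
    2 (a b + b a) + K^2 / 8 ([casimir_dZ]), the formula for P follows by
    comparing coefficients ([coefP_casimir]). The two commutators follow from
    the formula for P on c h_l and the same relations alone, by moving b to
    the left of a ([coefP_dZ] and [coefP_dZbar]).

    The analytic content is that left-invariant derivatives represent su(2):
    they are real-linear in the direction, preserve smoothness, and their
    commutators are the derivatives along the brackets ([cder_comm]). A smooth
    function on SU(2) extends locally to the vector space of 2 x 2 matrices,
    where the left-invariant field of A becomes the linear field g |-> g A.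
    For linear fields the claim is the chain rule together with the symmetry of
    second derivatives ([derive_swap]), which is obtained from the mean value
    theorem applied to second differences. *)

(** * Smooth functions on a real normed space *)

Section SmoothCalculus.
Context {R : realType} {V : normedModType R}.
Implicit Types (U : set V) (f g : V -> R) (k : nat).

(** The difference g - f vanishes near x, hence has derivative zero there. *)
Lemma near_eq_differentiable f g (x : V) :
  (\near x, f x = g x) -> differentiable f x -> differentiable g x.
Proof.
move=> fg df.
have h0 : \forall y \near (0:V), (g - f) (y + x) = 0.
  move: fg; rewrite (near_shift 0) subr0 => fg0.
  by apply: filterS fg0 => y /= fgy; rewrite !fctE fgy subrr.
have gfx0 : (g - f) x = 0 by have := nbhs_singleton h0; rewrite add0r.
have e : (g - f) \o shift x = cst ((g - f) x) + (\0 : V -> R) +o_0 id.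
  apply/eqaddoP => eps eps0; near=> y.
  have gf0 : (g - f) (y + x) = 0 by near: y.
  by rewrite /= !fctE /= in gf0 gfx0 *; rewrite gf0 gfx0 addr0 subrr normr0 mulr_ge0// ltW.
have c0 : continuous (\0 : V -> R) by move=> y; exact: cst_continuous.
have dh : differentiable (g - f) x.
  apply/diff_locallyP; rewrite (diff_unique c0 e).
  by split.
by rewrite -(subrK f g); exact: differentiableD.
Unshelve. all: by end_near. Qed.


Lemma open_eq_near U f g x : open U -> U x -> {in U, f =1 g} ->
  \near x, f x = g x.
Proof.
move=> oU Ux fg; have : nbhs x U by exact: open_nbhs_nbhs.
by apply: filterS => y Uy; apply: fg; rewrite inE.
Qed.

Lemma smooth_upto_eq k U f g : open U -> {in U, f =1 g} ->
  smooth_upto k U f -> smooth_upto k U g.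
Proof.
move=> oU; elim: k f g => [|k IH] f g fg /=.
  move=> cf x Ux; have fgx := open_eq_near oU Ux fg.
  rewrite /prop_for /continuous_at -fg ?inE//.
  apply: cvg_trans (cf x Ux); apply: near_eq_cvg.
  by apply: filterS fgx.
move=> [df sf]; split=> [x Ux|v].
  exact: near_eq_differentiable (open_eq_near oU Ux fg) (df x Ux).
apply: IH (sf v) => x; rewrite inE => Ux.
exact: near_eq_derive (open_eq_near oU Ux fg).
Qed.

Lemma smooth_on_eq U f g : open U -> {in U, f =1 g} ->
  smooth_on U f -> smooth_on U g.
Proof. by move=> oU fg sf k; exact: smooth_upto_eq (sf k). Qed.

Lemma smooth_upto_sub k U U' f : U' `<=` U -> smooth_upto k U f ->
  smooth_upto k U' f.
Proof.
move=> UU; elim: k f => [|k IH] f /=; first by move=> cf x /UU; exact: cf.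
by move=> [df sf]; split=> [x /UU|v]; [exact: df|exact: IH].
Qed.

Lemma smooth_on_sub U U' f : U' `<=` U -> smooth_on U f -> smooth_on U' f.
Proof. by move=> UU sf k; exact: smooth_upto_sub (sf k). Qed.

Lemma smooth_upto_pred k U f : smooth_upto k.+1 U f -> smooth_upto k U f.
Proof.
elim: k f => [|k IH] f [df sf].
  by move=> x Ux; apply: differentiable_continuous; exact: df.
by split=> // v; exact: IH (sf v).
Qed.

Lemma smooth_on_differentiable U f x : smooth_on U f -> U x ->
  differentiable f x.
Proof. by move=> /(_ 1) [df _]; exact: df. Qed.

Lemma smooth_on_derive U f v : smooth_on U f -> smooth_on U ('D_v f).
Proof. by move=> sf k; have [_] := sf k.+1; exact. Qed.

Lemma smooth_on_continuous U f x : smooth_on U f -> U x -> {for x, continuous f}.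
Proof. by move=> sf Ux; exact: (sf 0). Qed.

Lemma smooth_uptoD k U f g : open U ->
  smooth_upto k U f -> smooth_upto k U g -> smooth_upto k U (f + g).
Proof.
move=> oU; elim: k f g => [|k IH] f g.
  by move=> cf cg x Ux; apply: continuousD; [exact: cf|exact: cg].
move=> [df sf] [dg sg]; split=> [x Ux|v].
  by apply: differentiableD; [exact: df|exact: dg].
apply: smooth_upto_eq (IH _ _ (sf v) (sg v)) => // x; rewrite inE => Ux.
by rewrite deriveD//; apply: diff_derivable; [exact: df|exact: dg].
Qed.

Lemma smooth_uptoM k U f g : open U ->
  smooth_upto k U f -> smooth_upto k U g -> smooth_upto k U (f * g).
Proof.
move=> oU; elim: k f g => [|k IH] f g.
  by move=> cf cg x Ux; apply: continuousM; [exact: cf|exact: cg].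
move=> sf' sg'; have [df sf] := sf'; have [dg sg] := sg'; split=> [x Ux|v].
  by apply: differentiableM; [exact: df|exact: dg].
have s1 := IH _ _ (smooth_upto_pred sf') (sg v).
have s2 := IH _ _ (smooth_upto_pred sg') (sf v).
apply: smooth_upto_eq (smooth_uptoD oU s1 s2) => // x; rewrite inE => Ux.
by rewrite deriveM//; apply: diff_derivable; [exact: df|exact: dg].
Qed.

Lemma smooth_upto_cst k U (a : R) : smooth_upto k U (cst a).
Proof.
elim: k a => [|k IH] a; first by move=> x _; exact: cst_continuous.
split=> [x _|v]; first exact: differentiable_cst.
have -> : 'D_v (cst a) = cst 0 :> (V -> R) by apply/funext => x; exact: derive_cst.
exact: IH.
Qed.

Lemma smooth_on_cst U (a : R) : smooth_on U (cst a).
Proof. by move=> k; exact: smooth_upto_cst. Qed.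

Lemma smooth_onD U f g : open U ->
  smooth_on U f -> smooth_on U g -> smooth_on U (f + g).
Proof. by move=> oU sf sg k; exact: smooth_uptoD. Qed.

Lemma smooth_onM U f g : open U ->
  smooth_on U f -> smooth_on U g -> smooth_on U (f * g).
Proof. by move=> oU sf sg k; exact: smooth_uptoM. Qed.

Lemma smooth_on_sum (I : Type) (r : seq I) U (F : I -> V -> R) : open U ->
  (forall i, smooth_on U (F i)) -> smooth_on U (\sum_(i <- r) F i).
Proof.
move=> oU sF; elim/big_ind : _ => //; first exact: smooth_on_cst.
by move=> f g; exact: smooth_onD.
Qed.

Lemma smooth_on_linear U (f : {linear V -> R}) : continuous f -> smooth_on U f.
Proof.
move=> cf [|k]; first by move=> x _; exact: cf.
split=> [x _|v]; first exact: linear_differentiable.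
have -> : 'D_v f = cst (f v).
  by apply/funext => x; rewrite deriveE ?diff_lin//; exact: linear_differentiable.
exact: smooth_upto_cst.
Qed.

Lemma is_derive_line (f : V -> R) (y v : V) (s : R) :
  differentiable f (y + s *: v) ->
  is_derive s 1 (fun t : R => f (y + t *: v)) ('D_v f (y + s *: v)).
Proof.
move=> df.
have dl : is_diff s (fun t : R => y + t *: v) (fun t => t *: v).
  have := is_diffD (is_diff_cst y s) (is_diff_scalel s v).
  by rewrite add0r.
have dd := ex_diff (is_diff_def := dl).
have dc : differentiable (f \o (fun t : R => y + t *: v)) s.
  exact: differentiable_comp.
apply: DeriveDef; first exact: diff_derivable.
rewrite deriveE// (diff_comp dd df) /=.
by rewrite (@diff_val _ _ _ _ _ _ _ dl) scale1r -deriveE.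
Qed.

Lemma MVT_line (f : V -> R) (y v : V) (h : R) : 0 < h ->
  (forall s, 0 <= s <= h -> differentiable f (y + s *: v)) ->
  exists2 s, 0 <= s <= h & f (y + h *: v) - f y = 'D_v f (y + s *: v) * h.
Proof.
move=> h0 df.
have [s| |s sh E] := @MVT_segment _ (fun t => f (y + t *: v))
    (fun t => 'D_v f (y + t *: v)) 0 h (ltW h0).
- rewrite in_itv /= => /andP[s0 sh]; apply: is_derive_line; apply: df.
  by rewrite !ltW.
- apply: derivable_within_continuous => s; rewrite in_itv /= => sh.
  by have [] := is_derive_line (df _ sh).
- exists s; first by move: sh; rewrite in_itv.
  by move: E; rewrite scale0r addr0 subr0.
Qed.

Definition diff2 (f : V -> R) (x v w : V) : R :=
  f (x + v + w) - f (x + v) - (f (x + w) - f x).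

Lemma diff2C f x v w : diff2 f x v w = diff2 f x w v.
Proof. by rewrite /diff2 [x + w + v]addrAC; ring. Qed.

(** Two applications of the mean value theorem, first along v and then along w,
    express the second difference as h^2 times the mixed derivative at some
    point of the parallelogram; continuity of that derivative gives the
    limit. *)
Lemma cvg_diff2 U (f : V -> R) (x v w : V) : open U -> U x -> smooth_on U f ->
  diff2 f x (h *: v) (h *: w) / h ^+ 2 @[h --> 0^'+] --> 'D_w ('D_v f) x.
Proof.
move=> oU Ux sf.
have sfv := smooth_on_derive v sf; have sfvw := smooth_on_derive w sfv.
have nU : nbhs x U by exact: open_nbhs_nbhs.
apply/cvgrPdist_le => eps eps0.
have /cvgrPdist_le/(_ eps eps0) ce := smooth_on_continuous sfvw Ux.
have [d /= d0 dP] := (nbhs_normP _ _).1 (filterI nU ce).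
(* The summand 1 keeps the divisor positive when v = w = 0. *)
pose m := `|v| + `|w| + 1.
have m0 : 0 < m by rewrite ltr_wpDl ?addr_ge0.
near=> h.
have h0 : 0 < h by near: h; exact: nbhs_right_gt.
have hd : h * m < d.
  by rewrite -ltr_pdivlMr//; near: h; apply: nbhs_right_lt; rewrite divr_gt0.
have inb s t : 0 <= s <= h -> 0 <= t <= h ->
    U (x + s *: v + t *: w) /\
    `|'D_w ('D_v f) x - 'D_w ('D_v f) (x + s *: v + t *: w)| <= eps.
  move=> /andP[s0 sh] /andP[t0 th]; apply: dP => /=.
  rewrite -addrA opprD addNKr normrN.
  apply: (le_lt_trans (ler_normD _ _)); rewrite !normrZ !ger0_norm//.
  apply: le_lt_trans hd; rewrite /m !mulrDr mulr1.
  rewrite -[leLHS]addr0; apply: lerD; last exact: ltW.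
  by apply: lerD; apply: ler_wpM2r.
have hh : 0 <= h <= h by rewrite lexx ltW.
have z h' : 0 <= h' -> 0 <= (0:R) <= h' by move=> ->; rewrite lexx.
have h00 := z _ (ltW h0).
pose F y := f (y + h *: w) - f y.
have dF s : 0 <= s <= h -> differentiable F (x + s *: v) /\
  'D_v F (x + s *: v) = 'D_v f (x + s *: v + h *: w) - 'D_v f (x + s *: v).
  move=> sh; have [U1 _] := inb _ _ sh hh; have [U2 _] := inb _ _ sh h00.
  rewrite scale0r addr0 in U2.
  have D1 := smooth_on_differentiable sf U1.
  have D2 := smooth_on_differentiable sf U2.
  have ds : is_diff (x + s *: v) (fun y => y + h *: w) id.
    have := is_diffD (is_diff_id (x + s *: v)) (is_diff_cst (h *: w) (x + s *: v)).
    by rewrite addr0.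
  have dd := ex_diff (is_diff_def := ds).
  have dc : differentiable (f \o (fun y => y + h *: w)) (x + s *: v).
    exact: differentiable_comp.
  have -> : F = (f \o (fun y => y + h *: w)) - f by [].
  split; first exact: differentiableB.
  rewrite deriveB; [|exact: diff_derivable..].
  congr (_ - _); rewrite deriveE// (diff_comp dd D1) /=.
  by rewrite (@diff_val _ _ _ _ _ _ _ ds) /= -deriveE.
have [s sh E1] := MVT_line h0 (fun s sh => (dF s sh).1).
have [t th E2] : exists2 t, 0 <= t <= h &
    'D_v f (x + s *: v + h *: w) - 'D_v f (x + s *: v) =
    'D_w ('D_v f) (x + s *: v + t *: w) * h.
  apply: (@MVT_line ('D_v f) (x + s *: v) w h h0) => t th; have [U1 _] := inb _ _ sh th.
  exact: smooth_on_differentiable U1.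
have -> : diff2 f x (h *: v) (h *: w) = F (x + h *: v) - F x by [].
rewrite E1 (dF s sh).2 E2 -mulrA -expr2 mulfK ?expf_neq0 ?gt_eqF//.
by have [] := inb _ _ sh th.
Unshelve. all: by end_near. Qed.

(** The second difference is symmetric in v and w, so its two limits agree. *)
Lemma derive_swap U (f : V -> R) (x v w : V) : open U -> U x -> smooth_on U f ->
  'D_w ('D_v f) x = 'D_v ('D_w f) x.
Proof.
move=> oU Ux sf; have c1 := cvg_diff2 (v := v) (w := w) oU Ux sf.
have c2 := cvg_diff2 (v := w) (w := v) oU Ux sf.
have e : (fun h : R => diff2 f x (h *: w) (h *: v) / h ^+ 2) =
         (fun h : R => diff2 f x (h *: v) (h *: w) / h ^+ 2).
  by apply/funext => h; rewrite diff2C.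
by rewrite e in c2; exact: cvg_unique c1 c2.
Qed.

End SmoothCalculus.

Lemma is_derive_bigsum {R : realType} {V : normedModType R} (I : Type)
    (r : seq I) (F : I -> V -> R) (dF : I -> R) (x u : V) :
  (forall i, is_derive x u (F i) (dF i)) ->
  is_derive x u (\sum_(i <- r) F i) (\sum_(i <- r) dF i).
Proof.
move=> h; elim/big_ind2 : _ => //; first exact: is_derive_cst.
by move=> f df g dg hf hg; exact: is_deriveD.
Qed.

(** * Linear vector fields and their commutators *)

Section LinearVectorFields.
Context {R : realType} {V : normedModType R} {I : finType}.
Variables (b : I -> V) (co : I -> {linear V -> R}).
Hypothesis co_continuous : forall i, continuous (co i).
Hypothesis coE : forall v, v = \sum_i co i v *: b i.
Implicit Types (U : set V) (f : V -> R) (L K : {linear V -> V}).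

Definition lin_field L f : V -> R := fun x => 'D_(L x) f x.

Lemma linear_coord_continuous L : continuous L.
Proof.
have -> : (L : V -> V) = \sum_i (fun x => co i x *: L (b i)).
  apply/funext => x; rewrite fct_sumE {1}(coE x) linear_sum.
  by apply: eq_bigr => i _; rewrite linearZ.
elim/big_ind : _ => [|f g cf cg|i _]; first exact: cst_continuous.
  by move=> x; apply: continuousD; [exact: cf|exact: cg].
by move=> x; apply: cvgZr_tmp; exact: co_continuous.
Qed.

Lemma derive_coord f x v : differentiable f x ->
  'D_v f x = \sum_i co i v * 'D_(b i) f x.
Proof.
move=> df; rewrite deriveE// [in LHS](coE v) linear_sum; apply: eq_bigr => i _.
by rewrite linearZ deriveE.
Qed.

Lemma derive_add f x v w : differentiable f x ->
  'D_(v + w) f x = 'D_v f x + 'D_w f x.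
Proof. by move=> df; rewrite !deriveE// linearD. Qed.

Lemma derive_scale f x (t : R) v : differentiable f x ->
  'D_(t *: v) f x = t * 'D_v f x.
Proof. by move=> df; rewrite !deriveE// linearZ. Qed.

(** In coordinates a linear vector field has linear coefficients; this is what
    makes the derivative along it smooth, and what allows it to be
    differentiated again. *)
Lemma lin_fieldE U L f : smooth_on U f ->
  {in U, lin_field L f =1 \sum_i ((co i \o L) * 'D_(b i) f)}.
Proof.
move=> sf x; rewrite inE => Ux; rewrite /lin_field derive_coord; last first.
  exact: smooth_on_differentiable Ux.
by rewrite fct_sumE.
Qed.

Lemma smooth_lin_field U L f : open U ->
  smooth_on U f -> smooth_on U (lin_field L f).
Proof.
move=> oU sf.
have lE : {in U, \sum_i ((co i \o L) * 'D_(b i) f) =1 lin_field L f}.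
  by move=> x Ux; rewrite (lin_fieldE L sf).
apply: (smooth_on_eq oU lE); apply: smooth_on_sum => // i.
apply: smooth_onM => //; last exact: smooth_on_derive.
have cc : continuous (co i \o L) by move=> x; apply: continuous_comp; [exact: linear_coord_continuous|exact: co_continuous].
exact: (@smooth_on_linear _ _ _ (co i \o L)).
Qed.

(** Leibniz rule: the first sum differentiates f twice, the last term
    differentiates the coefficients of the field. *)
Lemma derive_lin_field U L f x u : open U -> U x -> smooth_on U f ->
  'D_u (lin_field L f) x =
  \sum_i (co i (L x) * 'D_u ('D_(b i) f) x) + 'D_(L u) f x.
Proof.
move=> oU Ux sf.
rewrite (near_eq_derive _ (open_eq_near oU Ux (lin_fieldE L sf))).
have dcL i : is_derive x u (co i \o L) (co i (L u)).
  have cc : continuous (co i \o L) by move=> y; apply: continuous_comp; [exact: linear_coord_continuous|exact: co_continuous].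
  have dd : differentiable (co i \o L) x by exact: (@linear_differentiable _ _ _ (co i \o L)).
  apply: DeriveDef; first exact: diff_derivable.
  by rewrite deriveE// (@diff_lin _ _ _ (co i \o L)).
have ddf i : derivable ('D_(b i) f) x u.
  apply: diff_derivable.
  exact: smooth_on_differentiable (smooth_on_derive (b i) sf) Ux.
have dF i : is_derive x u ((co i \o L) * 'D_(b i) f)
    (co i (L x) * 'D_u ('D_(b i) f) x + 'D_(b i) f x * co i (L u)).
  by have := is_deriveM (dcL i) (derivableP (ddf i)).
have -> := @derive_val _ _ _ _ _ _ _ (is_derive_bigsum (index_enum I) dF).
rewrite big_split /=; congr (_ + _).
rewrite derive_coord; last exact: smooth_on_differentiable Ux.
by apply: eq_bigr => i _; rewrite mulrC.
Qed.

(** The second-order terms cancel by the symmetry of second derivatives; what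
    remains is the derivative along the commutator of the linear maps. *)
Lemma lin_field_comm U L K f x : open U -> U x ->
  smooth_on U f ->
  lin_field L (lin_field K f) x - lin_field K (lin_field L f) x = 'D_(K (L x) - L (K x)) f x.
Proof.
move=> oU Ux sf; have df := smooth_on_differentiable sf Ux.
have sb i := smooth_on_derive (b i) sf.
have e1 : lin_field L (lin_field K f) x = _ := derive_lin_field K (L x) oU Ux sf.
have e2 : lin_field K (lin_field L f) x = _ := derive_lin_field L (K x) oU Ux sf.
have dd u i : 'D_u ('D_(b i) f) x = \sum_j co j u * 'D_(b j) ('D_(b i) f) x.
  exact: derive_coord (smooth_on_differentiable (sb i) Ux).
have sym : \sum_i co i (K x) * 'D_(L x) ('D_(b i) f) x =
          \sum_i co i (L x) * 'D_(K x) ('D_(b i) f) x.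
  transitivity (\sum_i \sum_j co i (K x) * (co j (L x) * 'D_(b j) ('D_(b i) f) x)).
    by apply: eq_bigr => i _; rewrite dd mulr_sumr.
  rewrite exchange_big /=; apply: eq_bigr => i _.
  rewrite dd mulr_sumr; apply: eq_bigr => j _.
  rewrite (derive_swap (b i) (b j) oU Ux sf); exact: mulrCA.
have e3 : 'D_(K (L x)) f x = 'D_(K (L x) - L (K x)) f x + 'D_(L (K x)) f x.
  by have := derive_add (K (L x) - L (K x)) (L (K x)) df; rewrite subrK.
have alg (A B s1 s2 k l m : R) :
  A = s1 + k -> B = s2 + l -> s1 = s2 -> k = m + l -> A - B = m.
  by move=> -> -> -> ->; ring.
exact: alg e1 e2 sym e3.
Qed.
End LinearVectorFields.

(** * One-parameter subgroups of SU(2) *)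

Section Exponential.
Context {R : realType}.
Local Notation C := R[i].
Local Notation M2 := 'M[C]_2.

(** On su(2) one has A ^+ 2 = - \det A, so that the even and the odd powers of A
    sum to the cosine and sine series of th = sqrt (\det A). *)
Lemma expm_cos_sin (A : M2) (th : R) : su2 A -> \det A = (th ^+ 2)%:C ->
  (th = 0 -> A = 0) ->
  expm A = (cos th)%:C *: 1 + (sin th / th)%:C *: A.
Proof.
move=> sA dA th0; apply/matrixP => i j.
have ReM (x : R) (z : C) : complex.Re (x%:C * z) = x * complex.Re z.
  by case: z => u v; simpc.
have ImM (x : R) (z : C) : complex.Im (x%:C * z) = x * complex.Im z.
  by case: z => u v; simpc.
have lim_cs (p q : R) :
    series (cos_coeff th) n * p + series (sin_coeff th) n / th * q
      @[n --> \oo] --> cos th * p + sin th / th * q.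
  have cc : series (cos_coeff th) n @[n --> \oo] --> cos th.
    by rewrite unlock; exact: is_cvg_series_cos_coeff.
  have cs : series (sin_coeff th) n @[n --> \oo] --> sin th.
    by rewrite unlock; exact: is_cvg_series_sin_coeff.
  by apply: cvgD; apply: cvgMr_tmp => //; exact: cvgMr_tmp.
have partial n : (\sum_(k < n) (k`!%:R : C)^-1 *: A ^+ k) i j =
    (series (cos_coeff th) n)%:C * (1 : M2) i j +
    (series (sin_coeff th) n / th)%:C * A i j.
  rewrite summxE /series /= !big_mkord mulr_suml !rmorph_sum !mulr_suml.
  rewrite -big_split /=; apply: eq_bigr => k _.
  by rewrite (su2_exp_term _ sA dA th0) !mxE.
have -> : ((cos th)%:C *: 1 + (sin th / th)%:C *: A) i j =
    (cos th)%:C * (1 : M2) i j + (sin th / th)%:C * A i j by rewrite !mxE.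
rewrite mxE /clim; under eq_fun do rewrite partial raddfD /= !ReM.
under [X in _ +i* limn X]eq_fun do rewrite partial raddfD /= !ImM.
rewrite !(cvg_lim _ (lim_cs _ _))//.
by apply/eqP; rewrite eq_complex !raddfD /= !ReM !ImM !eqxx.
Qed.

(** Only the first-order behaviour of the coefficients at 0 matters for
    derivatives along one-parameter subgroups. *)
Lemma expSU2_line (A : M2) : su2 A -> exists cs sn : R -> R,
  [/\ is_derive (0:R) (1:R) cs 0, is_derive (0:R) (1:R) sn 1, cs 0 = 1, sn 0 = 0 &
      forall t, SU2_mx (expSU2 (t%:C *: A)) = (cs t)%:C *: 1 + (sn t)%:C *: A].
Proof.
move=> sA; have [th dA th0] := su2_det sA.
(* For th = 0 the quotient has value 0; the substitute t has the required slope. *)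
have sinth t : sin (t * th) / (t * th) * t = (if th == 0 then t else sin (t * th) / th) \/ A = 0.
  have [/th0 ->|thn0] := eqVneq th 0; [by right|left].
  have [->|tn0] := eqVneq t 0; first by rewrite mul0r sin0 !mulr0 mul0r.
  by field; rewrite tn0 thn0.
have dl : is_derive (0:R) (1:R) (fun t : R => t * th) th.
  apply: (is_derive_eq (is_deriveM (is_derive_id (0:R) 1) (is_derive_cst th (0:R) 1))).
  rewrite /GRing.scale /=; ring.
exists (fun t => cos (t * th)), (fun t => if th == 0 then t else sin (t * th) / th).
split.
- apply: (is_derive_eq (is_derive1_comp (f := cos) (is_derive_cos _) dl)).
  by rewrite mul0r sin0 oppr0 mul0r.
- have [_|thn0] := eqVneq th 0; first exact: is_derive_id.
  have h := is_derive1_comp (f := sin) (is_derive_sin _) dl.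
  apply: (is_derive_eq (is_deriveM h (is_derive_cst th^-1 (0:R) 1))).
  by rewrite /GRing.scale /= mul0r cos0; field.
- by rewrite mul0r cos0.
- by rewrite mul0r sin0 mul0r if_same.
- move=> t; rewrite val_expSU2; last exact: su2Z.
  rewrite (@expm_cos_sin _ (t * th)).
  + rewrite scalerA -rmorphM /=; case: (sinth t) => [->//|->].
    by rewrite !scaler0.
  + exact: su2Z.
  + rewrite detZ dA -rmorphXn -rmorphM; congr (_%:C); ring.
  + move=> /eqP; rewrite mulf_eq0 => /orP[]/eqP; first by move->; rewrite scale0r.
    by move/th0 ->; rewrite scaler0.
Qed.
End Exponential.

Section RealCoordinates.
Context {R : realType}.
Local Notation C := R[i].
Local Notation M2 := 'M[C]_2.
Local Notation V := ('M[R]_2 * 'M[R]_2)%type.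

(** The map [reim], extended to all complex matrices, where it is additive. *)
Definition mx_reim (M : M2) : V := (map_mx (@complex.Re R) M, map_mx (@complex.Im R) M).

Lemma mx_reimD M N : mx_reim (M + N) = mx_reim M + mx_reim N.
Proof. by congr pair; apply/matrixP => i j; rewrite !mxE raddfD. Qed.

Lemma mx_reimB M N : mx_reim (M - N) = mx_reim M - mx_reim N.
Proof. by congr pair; apply/matrixP => i j; rewrite !mxE raddfB. Qed.

Lemma mx_reimZ (a : R) M : mx_reim (a%:C *: M) = a *: mx_reim M.
Proof.
by congr pair; apply/matrixP => i j; rewrite !mxE; case: (M i j) => x y; simpc.
Qed.

(** Right multiplication by A, read in real coordinates. *)
Definition rmul (A : M2) (p : V) : V :=
  (p.1 *m (mx_reim A).1 - p.2 *m (mx_reim A).2, p.1 *m (mx_reim A).2 + p.2 *m (mx_reim A).1).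

Lemma rmul_is_linear A : linear (rmul A).
Proof.
move=> a p q; congr pair => /=.
  by rewrite !mulmxDl -!scalemxAl scalerBr opprD addrACA.
by rewrite !mulmxDl -!scalemxAl scalerDr addrACA.
Qed.
HB.instance Definition _ A := GRing.isLinear.Build _ _ _ _ (rmul A) (rmul_is_linear A).

Lemma mx_reimM M A : mx_reim (M *m A) = rmul A (mx_reim M).
Proof.
congr pair; apply/matrixP => i j; rewrite !mxE raddf_sum /= -?sumrB -?big_split;
  by apply: eq_bigr => k _; rewrite !mxE; case: (M i k) (A k j) => [x y] [z t].
Qed.

Lemma rmulD A B p : rmul (A + B) p = rmul A p + rmul B p.
Proof.
rewrite /rmul mx_reimD; congr pair => /=; rewrite !mulmxDr ?opprD addrACA//.
Qed.

Lemma rmulZ (a : R) A p : rmul (a%:C *: A) p = a *: rmul A p.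
Proof.
by rewrite /rmul mx_reimZ; congr pair => /=; rewrite -!scalemxAr ?scalerBr ?scalerDr.
Qed.

Definition rbasis (k : bool * ('I_2 * 'I_2)) : V :=
  if k.1 then (delta_mx k.2.1 k.2.2, 0) else (0, delta_mx k.2.1 k.2.2).

Definition rcoord (k : bool * ('I_2 * 'I_2)) (p : V) : R :=
  (if k.1 then p.1 else p.2) k.2.1 k.2.2.

Lemma rcoord_is_linear k : linear_for *%R (rcoord k).
Proof. by move=> a p q; rewrite /rcoord; case: ifP => _; rewrite !mxE. Qed.
HB.instance Definition _ k := GRing.isLinear.Build R V R *%R (rcoord k) (rcoord_is_linear k).

Lemma rcoord_continuous k : continuous (rcoord k : V -> R).
Proof.
move=> p; rewrite /rcoord /continuous_at; case: k.1.
  exact: (continuous_comp (@cvg_fst _ _ _ _ _) (@coord_continuous _ _ _ _ _ _)).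
exact: (continuous_comp (@cvg_snd _ _ _ _ _) (@coord_continuous _ _ _ _ _ _)).
Qed.

Lemma rcoordE (p : V) : p = \sum_k rcoord k p *: rbasis k.
Proof.
rewrite -(pair_bigA _ (fun x y => rcoord (x, y) p *: rbasis (x, y))) /=.
rewrite big_bool /= /rcoord /rbasis /=.
have sumfst J (r : seq J) (F : J -> V) : (\sum_(j <- r) F j).1 = \sum_(j <- r) (F j).1.
  exact: (big_morph fst (fun _ _ => erefl) erefl).
have sumsnd J (r : seq J) (F : J -> V) : (\sum_(j <- r) F j).2 = \sum_(j <- r) (F j).2.
  exact: (big_morph snd (fun _ _ => erefl) erefl).
have sumP (P : 'M[R]_2) : \sum_(j : 'I_2 * 'I_2) P j.1 j.2 *: delta_mx j.1 j.2 = P.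
  by rewrite -(pair_bigA _ (fun x y => P x y *: delta_mx x y)) -matrix_sum_delta.
case: p => P Q; congr pair => /=; rewrite !(sumfst, sumsnd) /=.
  by rewrite [X in _ + X]big1 ?addr0 ?sumP// => i _; rewrite scaler0.
by rewrite big1 ?add0r ?sumP// => i _; rewrite scaler0.
Qed.

(** Naming the normed space and the two linear maps on it keeps the inference
    of the structures of a product of matrix spaces short. *)
Definition Mat2R : normedModType R := V.
Definition rmulL A : {linear Mat2R -> Mat2R} := rmul A.
Definition rcoordL k : {linear Mat2R -> R} := rcoord k.

Lemma rmulLD A B (p : Mat2R) : rmulL (A + B) p = rmulL A p + rmulL B p.
Proof. exact: rmulD. Qed.

Lemma rmulLZ (a : R) A (p : Mat2R) : rmulL (a%:C *: A) p = a *: rmulL A p.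
Proof. exact: rmulZ. Qed.

Lemma smooth_rmul A U (a : V -> R) : open U -> smooth_on U a ->
  smooth_on U (lin_field (rmulL A) a).
Proof. exact: (smooth_lin_field (co := rcoordL) rcoord_continuous rcoordE). Qed.

Lemma lin_field_rmul_comm A B U (a : V -> R) (p : V) : open U -> U p -> smooth_on U a ->
  lin_field (rmulL A) (lin_field (rmulL B) a) p - lin_field (rmulL B) (lin_field (rmulL A) a) p =
  'D_(rmulL B (rmulL A p) - rmulL A (rmulL B p)) a p.
Proof. exact: (lin_field_comm (co := rcoordL) rcoord_continuous rcoordE). Qed.
End RealCoordinates.

(** * Left-invariant derivatives on SU(2) *)

Section LeftDerivatives.
Context {R : realType}.
Local Notation C := R[i].
Local Notation M2 := 'M[C]_2.
Local Notation V := ('M[R]_2 * 'M[R]_2)%type.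
Local Notation G := (SU2 R).
Implicit Types (A B : M2) (g h : G).

Lemma su2D A B : su2 A -> su2 B -> su2 (A + B).
Proof.
move=> /andP[/eqP hA /eqP tA] /andP[/eqP hB /eqP tB]; apply/andP; split.
  by apply/eqP/matrixP => i j; move/matrixP/(_ i j): hA; move/matrixP/(_ i j): hB;
    rewrite !mxE rmorphD opprD /= => -> ->.
by rewrite mxtraceD tA tB addr0.
Qed.

Lemma su2_bracket A B : su2 A -> su2 B -> su2 (bracket A B).
Proof.
move=> /andP[/eqP hA _] /andP[/eqP hB _]; apply/andP; split; last first.
  by rewrite /bracket raddfB /= mxtrace_mulC subrr.
apply/eqP; rewrite /bracket linearB/= !map_mxB/= !trmx_mul !map_mxM/= hA hB.
by rewrite !mulNmx !mulmxN !opprK opprB.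
Qed.

(** Real-valued counterpart of [smooth_SU2]. *)
Definition rsmooth (c : G -> R) : Prop := forall g, exists (U : set V) (a : V -> R),
  [/\ open U, U (reim g), smooth_on U a & forall h, U (reim h) -> c h = a (reim h)].

Definition rder A (c : G -> R) : G -> R := fun g =>
  derive1 (fun t : R => c (g * expSU2 (t%:C *: A))%g) 0.

(** The curve g exp(t A) has velocity g A at t = 0, so the left-invariant
    derivative is the derivative of a local extension along the linear field
    given by right multiplication by A. *)
Lemma is_derive_left A g U (a : V -> R) (c : G -> R) : su2 A -> open U ->
  U (reim g) -> smooth_on U a -> (forall h, U (reim h) -> c h = a (reim h)) ->
  is_derive (0:R) (1:R) (fun t : R => c (g * expSU2 (t%:C *: A))%g)
    (lin_field (rmulL A) a (reim g)).
Proof.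
move=> sA oU Ug sa ca.
have [cs [sn [dcs dsn cs0 sn0 expE]]] := expSU2_line sA.
pose p : Mat2R := reim g; pose w : Mat2R := rmulL A p.
pose y (t : R) : Mat2R := cs t *: p + sn t *: w.
have yE t : reim (g * expSU2 (t%:C *: A))%g = y t.
  rewrite /y -[reim _]/(mx_reim (SU2_mx g *m SU2_mx (expSU2 (t%:C *: A)))) expE.
  by rewrite mulmxDr -!scalemxAr mulmx1 mx_reimD !mx_reimZ mx_reimM.
have y0 : y 0 = p by rewrite /y cs0 sn0 scale1r scale0r addr0.
have fcs : differentiable cs (0:R) by apply/derivable1_diffP.
have fsn : differentiable sn (0:R) by apply/derivable1_diffP.
have dy1 : differentiable (fun t => cs t *: p) (0:R) by exact: differentiableZl.
have dy2 : differentiable (fun t => sn t *: w) (0:R) by exact: differentiableZl.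
have dy : differentiable y (0:R) by exact: differentiableD.
have y'E : 'd y (0:R) 1 = w.
  have e := congr1 (fun k : R -> Mat2R => k 1) (diffD dy1 dy2).
  have e1 := congr1 (fun k : R -> Mat2R => k 1) (diffZl p fcs).
  have e2 := congr1 (fun k : R -> Mat2R => k 1) (diffZl w fsn).
  apply: (etrans e); apply: (etrans (congr2 +%R e1 e2)) => /=.
  have d1 : 'D_1 cs (0:R) = 0 := @derive_val _ _ _ _ _ _ _ dcs.
  have d2 : 'D_1 sn (0:R) = 1 := @derive_val _ _ _ _ _ _ _ dsn.
  rewrite (deriveE (1:R) fcs) in d1; rewrite (deriveE (1:R) fsn) in d2.
  by rewrite d1 d2 scale0r add0r scale1r.
have da : differentiable a (y 0).
  by rewrite y0; exact: smooth_on_differentiable sa Ug.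
have dc : differentiable (a \o y) (0:R) by exact: differentiable_comp.
have near_eq : \forall t \near (0:R), (a \o y) t = c (g * expSU2 (t%:C *: A))%g.
  have nU : nbhs (y 0) U by apply: open_nbhs_nbhs; rewrite y0.
  have yU : \forall t \near (0:R), U (y t) by exact: (differentiable_continuous dy nU).
  by apply: filterS yU => t Ut; rewrite /= -yE ca// yE.
apply: (near_eq_is_derive near_eq).
apply: DeriveDef; first exact: diff_derivable.
by rewrite deriveE// (diff_comp dy da) /= y'E y0 -deriveE// -y0.
Qed.

Lemma rder_ext A g U (a : V -> R) (c : G -> R) : su2 A -> open U ->
  U (reim g) -> smooth_on U a -> (forall h, U (reim h) -> c h = a (reim h)) ->
  rder A c g = lin_field (rmulL A) a (reim g).
Proof.
move=> sA oU Ug sa ca; have H := is_derive_left sA oU Ug sa ca.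
by rewrite /rder derive1E; exact: (@derive_val _ _ _ _ _ _ _ H).
Qed.

Lemma rderivable A c (g : G) : su2 A -> rsmooth c ->
  derivable (fun t : R => c (g * expSU2 (t%:C *: A))%g) 0 1.
Proof.
move=> sA sc; have [U [a [oU Ug sa ca]]] := sc g.
by have [] := is_derive_left sA oU Ug sa ca.
Qed.

Lemma rsmooth_rder A c : su2 A -> rsmooth c -> rsmooth (rder A c).
Proof.
move=> sA sc g; have [U [a [oU Ug sa ca]]] := sc g.
exists U, (lin_field (rmulL A) a); split => //.
  exact: smooth_rmul.
by move=> h Uh; exact: rder_ext Uh _ _.
Qed.

Lemma rderDl A B c : su2 A -> su2 B -> rsmooth c ->
  rder (A + B) c = rder A c + rder B c.
Proof.
move=> sA sB sc; apply/funext => g; have [U [a [oU Ug sa ca]]] := sc g.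
rewrite fctE !(rder_ext _ oU Ug sa ca) ?su2D// /lin_field rmulLD.
exact: derive_add (smooth_on_differentiable sa Ug).
Qed.

Lemma rderZl (t : R) A c : su2 A -> rsmooth c ->
  rder (t%:C *: A) c = t *: rder A c.
Proof.
move=> sA sc; apply/funext => g; have [U [a [oU Ug sa ca]]] := sc g.
rewrite fctE !(rder_ext _ oU Ug sa ca) ?su2Z// /lin_field rmulLZ.
exact: derive_scale (smooth_on_differentiable sa Ug).
Qed.

Lemma rderD A c d : su2 A -> rsmooth c -> rsmooth d ->
  rder A (c + d) = rder A c + rder A d.
Proof.
move=> sA sc sd; apply/funext => g.
change (rder A (c + d) g = rder A c g + rder A d g); rewrite /rder !derive1E.
exact: (deriveD (rderivable (g := g) sA sc) (rderivable (g := g) sA sd)).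
Qed.

Lemma rderZ A (t : R) c : su2 A -> rsmooth c -> rder A (t *: c) = t *: rder A c.
Proof.
move=> sA sc; apply/funext => g.
change (rder A (t *: c) g = t *: rder A c g); rewrite /rder !derive1E.
exact: (deriveZ t (rderivable (g := g) sA sc)).
Qed.

(** Right multiplication reverses products, which compensates the order of the
    linear maps in [lin_field_comm] and yields the bracket A B - B A. *)
Lemma rder_comm A B c : su2 A -> su2 B -> rsmooth c ->
  rder A (rder B c) - rder B (rder A c) = rder (bracket A B) c.
Proof.
move=> sA sB sc; apply/funext => g; have [U [a [oU Ug sa ca]]] := sc g.
have sl D : su2 D -> smooth_on U (lin_field (rmulL D) a).
  by move=> sD; exact: smooth_rmul.
have cl D : su2 D -> forall h, U (reim h) -> rder D c h = lin_field (rmulL D) a (reim h).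
  by move=> sD h Uh; exact: rder_ext Uh _ _.
rewrite !fctE (rder_ext sA oU Ug (sl B sB) (cl B sB)).
rewrite (rder_ext sB oU Ug (sl A sA) (cl A sA)).
rewrite (rder_ext (su2_bracket sA sB) oU Ug sa ca).
rewrite (lin_field_rmul_comm _ _ oU Ug sa) /lin_field; congr ('D_ _ a _).
have e : rmul B (rmul A (mx_reim g)) - rmul A (rmul B (mx_reim g)) = rmul (bracket A B) (mx_reim g).
  by rewrite -!mx_reimM -mx_reimB /bracket mulmxBr !mulmxA.
exact: e.
Qed.

Lemma rsmoothD c d : rsmooth c -> rsmooth d -> rsmooth (c + d).
Proof.
move=> sc sd g; have [U [a [oU Ug sa ca]]] := sc g.
have [W [b [oW Wg sb db]]] := sd g.
have oUW := openI oU oW.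
exists (U `&` W), (a + b); split => //.
  by apply: smooth_onD => //; [apply: smooth_on_sub sa|apply: smooth_on_sub sb] => x [].
by move=> h [Uh Wh]; rewrite !fctE ca// db.
Qed.

Lemma rsmoothZ (t : R) c : rsmooth c -> rsmooth (t *: c).
Proof.
move=> sc g; have [U [a [oU Ug sa ca]]] := sc g.
exists U, (cst t * a); split => //; first exact: smooth_onM (smooth_on_cst _ _) sa.
by move=> h Uh; rewrite !fctE ca.
Qed.

Definition reC (c : G -> C) : G -> R := fun g => complex.Re (c g).
Definition imC (c : G -> C) : G -> R := fun g => complex.Im (c g).

Lemma smooth_SU2P (c : G -> C) : smooth_SU2 c <-> rsmooth (reC c) /\ rsmooth (imC c).
Proof.
split=> [sc|[sr si] g].
  split=> g; have [U [a [b [[oU Ug] sa sb cE]]]] := sc g.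
    by exists U, a; split=> // h Uh; rewrite /reC cE.
  by exists U, b; split=> // h Uh; rewrite /imC cE.
have [U [a [oU Ug sa ca]]] := sr g; have [W [b [oW Wg sb db]]] := si g.
exists (U `&` W), a, b; split.
- by split=> //; exact: openI.
- by apply: smooth_on_sub sa => x [].
- by apply: smooth_on_sub sb => x [].
- move=> h [Uh Wh]; rewrite -ca// -db//; rewrite /reC /imC; by case: (c h).
Qed.

(** Left-invariant derivative of a scalar function. The body is locked, as
    comparing two such derivatives by unfolding is very expensive. *)
Definition cder : M2 -> (G -> C) -> G -> C := locked (fun A c g =>
  Cderive (fun t : R => c (g * expSU2 (t%:C *: A))%g) 0).

Lemma cderE A c g : cder A c g = Cderive (fun t : R => c (g * expSU2 (t%:C *: A))%g) 0.
Proof. by rewrite /cder -lock. Qed.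

Lemma reC_cder A c : reC (cder A c) = rder A (reC c).
Proof. by apply/funext => g; rewrite /reC cderE. Qed.
Lemma imC_cder A c : imC (cder A c) = rder A (imC c).
Proof. by apply/funext => g; rewrite /imC cderE. Qed.

Lemma cfun_eq (c d : G -> C) : reC c = reC d -> imC c = imC d -> c = d.
Proof.
move=> h1 h2; apply/funext => g; apply/eqP; rewrite eq_complex.
by rewrite -![complex.Re _]/(reC _ g) -![complex.Im _]/(imC _ g) h1 h2 !eqxx.
Qed.

Lemma reCD c d : reC (c + d) = reC c + reC d.
Proof. by apply/funext => g; rewrite /reC fctE raddfD. Qed.
Lemma imCD c d : imC (c + d) = imC c + imC d.
Proof. by apply/funext => g; rewrite /imC fctE raddfD. Qed.
Lemma reCZ (z : C) c : reC (z *: c) = complex.Re z *: reC c + (- complex.Im z) *: imC c.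
Proof.
apply/funext => g; rewrite /reC /imC !fctE.
case: z (c g) => [x y] [u v]; rewrite -[LHS]/(x * u - y * v) -[RHS]/(x * u + - y * v).
by rewrite mulNr.
Qed.
Lemma imCZ (z : C) c : imC (z *: c) = complex.Re z *: imC c + complex.Im z *: reC c.
Proof.
apply/funext => g; rewrite /reC /imC !fctE.
by case: z (c g) => [x y] [u v]; rewrite -[LHS]/(x * v + y * u).
Qed.

Lemma smoothD (c d : G -> C) : smooth_SU2 c -> smooth_SU2 d -> smooth_SU2 (c + d).
Proof.
move=> /smooth_SU2P[? ?] /smooth_SU2P[? ?]; apply/smooth_SU2P.
by rewrite reCD imCD; split; exact: rsmoothD.
Qed.

Lemma smoothZ z (c : G -> C) : smooth_SU2 c -> smooth_SU2 (z *: c).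
Proof.
move=> /smooth_SU2P[? ?]; apply/smooth_SU2P.
by rewrite reCZ imCZ; split; apply: rsmoothD; exact: rsmoothZ.
Qed.

Lemma smooth_cder A (c : G -> C) : su2 A -> smooth_SU2 c -> smooth_SU2 (cder A c).
Proof.
move=> sA /smooth_SU2P[? ?]; apply/smooth_SU2P.
by rewrite reC_cder imC_cder; split; exact: rsmooth_rder.
Qed.

Lemma cderD A (c d : G -> C) : su2 A -> smooth_SU2 c -> smooth_SU2 d ->
  cder A (c + d) = cder A c + cder A d.
Proof.
move=> sA /smooth_SU2P[? ?] /smooth_SU2P[? ?].
by apply: cfun_eq; rewrite ?(reC_cder, imC_cder, reCD, imCD) rderD.
Qed.

Lemma cderZ A z (c : G -> C) : su2 A -> smooth_SU2 c -> cder A (z *: c) = z *: cder A c.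
Proof.
move=> sA /smooth_SU2P[? ?].
by apply: cfun_eq; rewrite ?(reC_cder, imC_cder, reCZ, imCZ) rderD ?rderZ//; exact: rsmoothZ.
Qed.

Lemma cderDl A B (c : G -> C) : su2 A -> su2 B -> smooth_SU2 c ->
  cder (A + B) c = cder A c + cder B c.
Proof.
move=> sA sB /smooth_SU2P[sr si]; apply: cfun_eq.
  by rewrite reCD !reC_cder; exact: rderDl sA sB sr.
by rewrite imCD !imC_cder; exact: rderDl sA sB si.
Qed.

Lemma cderZl (t : R) A (c : G -> C) : su2 A -> smooth_SU2 c ->
  cder (t%:C *: A) c = t%:C *: cder A c.
Proof.
move=> sA /smooth_SU2P[sr si]; apply: cfun_eq.
  by rewrite reCZ !reC_cder /= oppr0 scale0r addr0; exact: rderZl sA sr.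
by rewrite imCZ !imC_cder /= scale0r addr0; exact: rderZl sA si.
Qed.

Lemma cder_comm A B (c : G -> C) : su2 A -> su2 B -> smooth_SU2 c ->
  cder A (cder B c) = cder B (cder A c) + cder (bracket A B) c.
Proof.
move=> sA sB /smooth_SU2P[sr si]; apply: cfun_eq.
  by rewrite reCD !reC_cder; apply/eqP; rewrite addrC -subr_eq; apply/eqP; exact: rder_comm sA sB sr.
by rewrite imCD !imC_cder; apply/eqP; rewrite addrC -subr_eq; apply/eqP; exact: rder_comm sA sB si.
Qed.
End LeftDerivatives.

(** * Hermite functions *)

Section Hermite.
Context {R : realType}.
Local Notation C := R[i].
Implicit Types (x : R) (l : nat).

Definition gauss (y : R) : R := expR (- y ^+ 2).

(** Strong induction: the recurrence at l expresses the next derivative through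
    differentiable functions, and differentiating it gives the recurrence at
    l + 1. *)
Lemma gauss_rec l :
  (forall x, is_derive x (1:R) (derive1n l gauss) (derive1n l.+1 gauss x)) /\
  (forall x, derive1n l.+1 gauss x =
     - 2 * x * derive1n l gauss x - 2 * l%:R * derive1n l.-1 gauss x).
Proof.
have is_der (f : R -> R) x d : is_derive x (1:R) f d -> is_derive x (1:R) f (derive1 f x).
  by move=> h; rewrite derive1E; apply: DeriveDef => //; case: h.
have dx2 x : is_derive x (1:R) (fun y : R => - y ^+ 2) (- 2 * x).
  have -> : (fun y : R => - y ^+ 2) = - ((id : R -> R) * id) by apply/funext => y; rewrite expr2.
  apply: (is_derive_eq (is_deriveN (is_deriveM (is_derive_id x (1:R)) (is_derive_id x (1:R))))).
  by rewrite /GRing.scale /=; ring.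
have d0 x : is_derive x (1:R) gauss (- 2 * x * gauss x).
  apply: (is_derive_eq (is_derive1_comp (f := @expR R) (is_derive_expR _) (dx2 x))).
  by rewrite /gauss; ring.
elim/ltn_ind: l => -[|l] IH.
  split=> x; first exact: is_der (d0 x).
  rewrite -[derive1n 1 gauss x]/(derive1 gauss x) derive1E.
  by rewrite (@derive_val _ _ _ _ _ _ _ (d0 x)) /=; ring.
have [dl recl] := IH l (ltnSn l).
have dl1 x : (0 < l)%N -> is_derive x (1:R) (derive1n l.-1 gauss) (derive1n l gauss x).
  move=> l0; have [h _] := IH l.-1 (leq_ltn_trans (leq_pred l) (ltnSn l)).
  by have := h x; rewrite (prednK l0).
have dE x : is_derive x (1:R) (derive1n l.+1 gauss)
    (- 2 * x * derive1n l.+1 gauss x - 2 * l.+1%:R * derive1n l gauss x).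
  have gE : derive1n l.+1 gauss = (fun x => - 2 * x) * derive1n l gauss
             - (2 * l%:R) *: derive1n l.-1 gauss.
    by apply/funext => y; rewrite recl.
  have dm : is_derive x (1:R) (fun x => - 2 * x) (-2).
    have := is_deriveZ (-2) (is_derive_id x (1:R)).
    by rewrite -[X in is_derive _ _ _ X]/(-2 * 1 : R) mulr1.
  have dB : is_derive x (1:R) ((2 * l%:R) *: derive1n l.-1 gauss)
              (2 * l%:R * derive1n l gauss x).
    have [->|l0] := posnP l; first by rewrite mulr0 scale0r mul0r; exact: is_derive_cst.
    exact: is_deriveZ (dl1 x l0).
  rewrite [X in is_derive _ _ X _]gE.
  apply: (is_derive_eq (is_deriveB (is_deriveM dm (dl x)) dB)).
  move: (derive1n l.+1 gauss x) (derive1n l gauss x) => u v.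
  by rewrite /GRing.scale /= -[l.+1%:R]natr1; ring.
split=> x; first exact: is_der (dE x).
rewrite -[LHS]/(derive1 (derive1n l.+1 gauss) x) derive1E.
by rewrite (@derive_val _ _ _ _ _ _ _ (dE x)).
Qed.

Lemma is_derive_hermite l x :
  is_derive x (1:R) (hermite l : R -> R) (x * hermite l x + hermite l.+1 x).
Proof.
have [/(_ x) dl _] := gauss_rec l.
have dx2 : is_derive x (1:R) (fun y : R => y ^+ 2 / 2) x.
  have -> : (fun y : R => y ^+ 2 / 2) = 2^-1 *: ((id : R -> R) * id).
    by apply/funext => y; rewrite expr2 mulrC.
  apply: (is_derive_eq (is_deriveZ 2^-1 (is_deriveM (is_derive_id x (1:R)) (is_derive_id x (1:R))))).
  by rewrite /GRing.scale /=; field.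
have de := is_derive1_comp (f := @expR R) (is_derive_expR _) dx2.
apply: (is_derive_eq (is_deriveM de dl)).
by rewrite /hermite /GRing.scale /=; ring.
Qed.

Lemma hermite_rec l x :
  hermite l.+1 x = - 2 * x * hermite l x - 2 * l%:R * hermite l.-1 x.
Proof. have [_ /(_ x) e] := gauss_rec l; rewrite /hermite e; ring. Qed.

(** If h_(l+1) vanished identically, so would its derivative and hence h_(l+2),
    and the recurrence would make h_l vanish. *)
Lemma hermite_neq0 l : exists x : R, hermite l x != 0.
Proof.
elim: l => [|l [y hy]]; first by exists 0; rewrite /hermite /= mulf_neq0 ?gt_eqF ?expR_gt0.
have [//|h0] := pselect (exists x : R, hermite l.+1 x != 0).
have z x : hermite l.+1 x = 0.
  by apply/eqP; apply: contrapT => hx; apply: h0; exists x; apply/negP.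
have z2 : hermite l.+2 y = 0.
  have zE : (hermite l.+1 : R -> R) = cst 0 by apply/funext.
  have := @derive_val _ _ _ _ _ _ _ (is_derive_hermite l.+1 y).
  by rewrite zE derive_cst /= mulr0 add0r.
have := hermite_rec l.+1 y; rewrite z2 z mulr0 sub0r -[l.+1.-1]/l => /esym/eqP.
by rewrite oppr_eq0 mulf_eq0 (negbTE hy) orbF mulf_eq0 !pnatr_eq0.
Qed.

Lemma Cderive_sum n (f f' : nat -> R -> R) (z : nat -> C) x :
  (forall l, is_derive x (1:R) (f l) (f' l x)) ->
  Cderive (fun y => \sum_(l < n) z l * (f l y)%:C) x =
  \sum_(l < n) z l * (f' l x)%:C.
Proof.
move=> df.
have ReM (w : C) (t : R) : complex.Re (w * t%:C) = complex.Re w * t.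
  by case: w => u v; simpc.
have ImM (w : C) (t : R) : complex.Im (w * t%:C) = complex.Im w * t.
  by case: w => u v; simpc.
have key (a : nat -> R) :
  derive1 (fun y => \sum_(l < n) a l * f l y) x = \sum_(l < n) a l * f' l x.
  have -> : (fun y => \sum_(l < n) a l * f l y) = \sum_(l < n) (a l *: f l).
    by apply/funext => y; rewrite fct_sumE.
  have dF (l : 'I_n) := is_deriveZ (a l) (df l).
  rewrite derive1E.
  exact: (@derive_val _ _ _ _ _ _ _ (is_derive_bigsum (index_enum 'I_n) dF)).
rewrite /Cderive; apply/eqP; rewrite eq_complex !raddf_sum /=.
apply/andP; split; apply/eqP.
  under [RHS]eq_bigr do rewrite ReM.
  rewrite -(key (fun l => complex.Re (z l))); congr (derive1 _ x).
  apply/funext => y /=; rewrite raddf_sum /=.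
  by apply: eq_bigr => l _; rewrite ReM.
under [RHS]eq_bigr do rewrite ImM.
rewrite -(key (fun l => complex.Im (z l))); congr (derive1 _ x).
apply/funext => y /=; rewrite raddf_sum /=.
by apply: eq_bigr => l _; rewrite ImM.
Qed.

(** By [is_derive_hermite] this is the second derivative of h_l, so the statement
    is the eigenvalue equation of the harmonic oscillator. *)
Lemma is_derive2_hermite l x :
  is_derive x (1:R) (fun y : R => y * hermite l y + hermite l.+1 y)
    ((x ^+ 2 - 2 * l%:R - 1) * hermite l x).
Proof.
have -> : (fun y : R => y * hermite l y + hermite l.+1 y) =
  (id : R -> R) * hermite l + hermite l.+1 by [].
apply: (is_derive_eq (is_deriveD (is_deriveM (is_derive_id x (1:R))
  (is_derive_hermite l x)) (is_derive_hermite l.+1 x))).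
have := hermite_rec l.+1 x; rewrite -[l.+1.-1]/l => ->.
by rewrite /GRing.scale /= -[l.+1%:R]natr1; ring.
Qed.
End Hermite.

(** * Coordinates on su(2) and adapted frames *)

Section Pauli.
Context {R : realType}.
Local Notation C := R[i].
Local Notation M2 := 'M[C]_2.
Local Notation G := (SU2 R).
Implicit Types (A B : M2) (a x y p q : R).

(** Coordinates in which g_0 is 8 times the Euclidean scalar product and the
    bracket is twice the cross product. *)
Definition pauli : R -> R -> R -> M2 := locked (fun a x y =>
  (0 +i* a) *: sl2_h R + (x +i* y) *: sl2_X R + (- x +i* y) *: sl2_Y R).

Lemma pauliE a x y : (pauli a x y 0 0 = 0 +i* a) * (pauli a x y 0 1 = x +i* y) *
  (pauli a x y 1 0 = - x +i* y) * (pauli a x y 1 1 = 0 -i* a).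
Proof. by rewrite /pauli -lock; do !split; rewrite !mxE /=; simpc. Qed.

Lemma pauli_coords A : su2 A ->
  A = pauli (complex.Im (A 0 0)) (complex.Re (A 0 1)) (complex.Im (A 0 1)).
Proof.
move=> sA; have h00 := su2_conj 0 0 sA; have h10 := su2_conj 1 0 sA.
have h11 := su2_tr sA; have e00 : complex.Re (A 0 0) = 0.
  case: (A 0 0) h00 => u v [/eqP].
  by rewrite -subr_eq0 opprK -mulr2n mulrn_eq0 /= => /eqP.
apply: matrix2P; rewrite pauliE.
- by case: (A 0 0) e00 => u v /= ->.
- by case: (A 0 1).
- by rewrite -[LHS]opprK -h10; case: (A 0 1) => s t; simpc.
- by rewrite h11; case: (A 0 0) e00 => u v /= ->; simpc.
Qed.

Lemma su2_pauli a x y : su2 (pauli a x y).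
Proof.
apply/andP; split; last by rewrite /mxtrace sum2E !pauliE; simpc.
by apply/eqP/matrix2P; rewrite !mxE !pauliE conjC_conjc; rewrite /conjc /=;
  simpc; rewrite ?opprK ?oppr0.
Qed.

Lemma pauli_tr a x y : pauli a x y 1 1 = - pauli a x y 0 0.
Proof. exact: su2_tr (su2_pauli a x y). Qed.

Lemma g0_pauli a x y a' x' y' :
  g0 (pauli a x y) (pauli a' x' y') = (8 * (a * a' + x * x' + y * y'))%:C.
Proof.
rewrite /g0 killing_tr ?pauli_tr// /mxtrace sum2E !mxE !sum2E !pauliE.
have -> : (4 : C) = (4 : R)%:C by rewrite rmorph_nat.
by simpc; congr (_ +i* _); ring.
Qed.

Lemma bracket_pauli a x y a' x' y' : bracket (pauli a x y) (pauli a' x' y') =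
  pauli (2 * (x * y' - y * x')) (2 * (y * a' - a * y')) (2 * (a * x' - x * a')).
Proof.
by apply: matrix2P; rewrite bracketE !pauliE; simpc; congr (_ +i* _); ring.
Qed.

Lemma pauliZ t a x y : pauli (t * a) (t * x) (t * y) = t%:C *: pauli a x y.
Proof.
by apply: matrix2P; rewrite [RHS]mxE !pauliE; simpc; congr (_ +i* _); ring.
Qed.

Lemma pauliD a x y a' x' y' :
  pauli (a + a') (x + x') (y + y') = pauli a x y + pauli a' x' y'.
Proof.
by apply: matrix2P; rewrite [RHS]mxE !pauliE; simpc; congr (_ +i* _); ring.
Qed.

Lemma torus_pauli a : lie_torus (pauli a 0 0).
Proof.
apply/andP; split; first exact: su2_pauli.
apply/is_diag_mxP => i j; case: (ord2P i) => ->; case: (ord2P j) => -> //= _;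
  by rewrite pauliE ?oppr0.
Qed.

(** Orthogonality to the torus removes the diagonal part; the root equation
    makes the lower left entry of Z zero, which determines F from E. *)
Lemma adapted_frame_pauli (E F : M2) : adapted_frame E F -> exists p q,
  [/\ E = pauli 0 p q, F = pauli 0 (- q) p & 8 * (p ^+ 2 + q ^+ 2) = 1].
Proof.
case=> sE sF /(_ _ (torus_pauli 1)) oE /(_ _ (torus_pauli 1)) oF gE _ _ [_ hZ] _.
move: hZ => /(_ _ (torus_pauli 1)).
have [a [p [q EE]]] : exists a p q, E = pauli a p q.
  by do 3!eexists; exact: pauli_coords sE.
have [a' [p' [q' FE]]] : exists a p q, F = pauli a p q.
  by do 3!eexists; exact: pauli_coords sF.
move: oE oF gE; rewrite EE FE !g0_pauli => /complexI oE /complexI oF /complexI gE.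
have a0 : a = 0.
  have {}oE : 8 * (1 * a + 0 * p + 0 * q) = 0 :> R := oE.
  by lra.
have a'0 : a' = 0.
  have {}oF : 8 * (1 * a' + 0 * p' + 0 * q') = 0 :> R := oF.
  by lra.
have {}gE : 8 * (a * a + p * p + q * q) = 1 :> R := gE.
rewrite a0 a'0 in gE *; move=> /matrixP/(_ 1 0).
rewrite bracketE /alpha /vZ !mxE !pauliE.
have -> : (2^-1 : C) = (2^-1 : R)%:C by rewrite fmorphV rmorph_nat.
simpc => -[h1 h2].
have e1 : q' = p by lra.
have e2 : p' = - q by lra.
by exists p, q; rewrite e1 e2; split=> //; lra.
Qed.

Lemma cder_pauli a x y (c : G -> C) : smooth_SU2 c ->
  cder (pauli a x y) c = a%:C *: cder (pauli 1 0 0) c +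
    (x%:C *: cder (pauli 0 1 0) c + y%:C *: cder (pauli 0 0 1) c).
Proof.
move=> sc.
have -> : pauli a x y =
    a%:C *: pauli 1 0 0 + (x%:C *: pauli 0 1 0 + y%:C *: pauli 0 0 1).
  by rewrite -!pauliZ -!pauliD; congr pauli; ring.
have sp := su2_pauli; have sZ t u v w := su2Z t (sp u v w).
rewrite (cderDl (sZ _ _ _ _) (su2D (sZ _ _ _ _) (sZ _ _ _ _)) sc).
rewrite (cderDl (sZ _ _ _ _) (sZ _ _ _ _) sc).
by rewrite (cderZl a (sp _ _ _) sc) (cderZl x (sp _ _ _) sc) (cderZl y (sp _ _ _) sc).
Qed.
End Pauli.

(** * The Casimir element and the Dolbeault derivatives *)

Section Operators.
Context {R : realType}.
Local Notation C := R[i].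
Local Notation M2 := 'M[C]_2.
Local Notation G := (SU2 R).
Implicit Types (A B : M2) (c d : G -> C).

Lemma smooth0 : smooth_SU2 (0 : G -> C).
Proof.
apply/smooth_SU2P; split=> g; exists setT, (cst 0);
  by split=> //; [exact: openT | exact: smooth_on_cst].
Qed.

Lemma smooth_sum n (F : nat -> G -> C) : (forall l, smooth_SU2 (F l)) ->
  smooth_SU2 (\sum_(l < n) F l).
Proof.
move=> sF; elim: n => [|n IH]; first by rewrite big_ord0; exact: smooth0.
by rewrite big_ord_recr; exact: smoothD.
Qed.

Lemma cder_sum n A (z : nat -> C) (F : nat -> G -> C) : su2 A ->
  (forall l, smooth_SU2 (F l)) ->
  cder A (\sum_(l < n) z l *: F l) = \sum_(l < n) z l *: cder A (F l).
Proof.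
move=> sA sF; elim: n => [|n IH].
  rewrite !big_ord0; have := cderZ 0 sA smooth0.
  by rewrite !scale0r.
rewrite !big_ord_recr /= cderD//; first by rewrite IH cderZ.
  by apply: (@smooth_sum n (fun l => z l *: F l)) => l; exact: smoothZ.
exact: smoothZ.
Qed.

Lemma cfunD c d g : (c + d) g = c g + d g. Proof. by []. Qed.
Lemma cfunN c g : (- c) g = - c g. Proof. by []. Qed.
Lemma cfunZ (z : C) c g : (z *: c) g = z * c g. Proof. by []. Qed.

Lemma sum3E (V : nmodType) (f : 'I_3 -> V) :
  \sum_i f i = f ord0 + (f (inord 1) + f (inord 2)).
Proof.
rewrite !big_ord_recl big_ord0 addr0.
by congr (_ + (f _ + f _)); apply: val_inj; rewrite /= inordK.
Qed.

(** The coordinates of the basis e form a matrix M with 8 M M^T = 1, hence also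
    8 M^T M = 1: the sum of squares does not depend on the orthonormal
    basis. *)
Lemma casimir_cder (e : 'I_3 -> M2) c : su2_onb e -> smooth_SU2 c ->
  \sum_(k < 3) cder (e k) (cder (e k) c) =
  8^-1 *: (cder (pauli 1 0 0) (cder (pauli 1 0 0) c) +
    (cder (pauli 0 1 0) (cder (pauli 0 1 0) c) +
     cder (pauli 0 0 1) (cder (pauli 0 0 1) c))).
Proof.
move=> [se oe] sc.
pose a k := complex.Im (e k 0 0); pose x k := complex.Re (e k 0 1).
pose y k := complex.Im (e k 0 1).
have eE k : e k = pauli (a k) (x k) (y k) by exact: pauli_coords.
pose M : 'M[R]_3 := \matrix_(k, j) [:: a k; x k; y k]`_j.
pose i1 : 'I_3 := inord 1; pose i2 : 'I_3 := inord 2.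
have v1 : i1 = 1%N :> nat by rewrite inordK.
have v2 : i2 = 2%N :> nat by rewrite inordK.
have sum3 (V : nmodType) (f : 'I_3 -> V) : \sum_i f i = f ord0 + (f i1 + f i2).
  exact: sum3E.
have MM : M *m (8 *: M^T) = 1%:M.
  apply/matrixP => j k; rewrite -scalemxAr !mxE sum3 !mxE !v1 !v2 /=.
  have := oe j k; rewrite !eE g0_pauli => h.
  apply: (@complexI R); apply: (etrans _ (etrans h _)); last by rewrite rmorph_nat.
  by congr (_ %:C); rewrite addrA.
have MtM := mulmx1C MM.
have orth i j : 8 * \sum_k M k i * M k j = (i == j)%:R.
  move/matrixP/(_ i j): MtM; rewrite -scalemxAl !mxE => <-; congr (_ * _).
  by apply: eq_bigr => k _; rewrite [M^T _ _]mxE.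
have orthC i j : ((M ord0 i)%:C * (M ord0 j)%:C + ((M i1 i)%:C * (M i1 j)%:C +
    (M i2 i)%:C * (M i2 j)%:C) = (i == j)%:R / 8 :> C)%R.
  rewrite -!rmorphM -!rmorphD -(sum3 _ (fun k => M k i * M k j)).
  rewrite (_ : \sum_k _ = (i == j)%:R / 8); last by rewrite -orth; field.
  by rewrite rmorphM fmorphV !rmorph_nat.
have [q11 q12 q13] := And3 (orthC ord0 ord0) (orthC ord0 i1) (orthC ord0 i2).
have [q22 q23 q33] := And3 (orthC i1 i1) (orthC i1 i2) (orthC i2 i2).
have n12 : (i1 == i2) = false by apply/eqP => /(congr1 val); rewrite /= v1 v2.
have n1 : (ord0 == i1) = false by apply/eqP => /(congr1 val); rewrite /= v1.
have n2 : (ord0 == i2) = false by apply/eqP => /(congr1 val); rewrite /= v2.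
rewrite !mxE !v1 !v2 /= ?eqxx ?n12 ?n1 ?n2 in q11 q12 q13 q22 q23 q33.
set d1 := cder (pauli 1 0 0); set d2 := cder (pauli 0 1 0); set d3 := cder (pauli 0 0 1).
have sd u v w (d : G -> C) : smooth_SU2 d -> smooth_SU2 (cder (pauli u v w) d).
  by move=> sd; exact: smooth_cder (su2_pauli _ _ _) sd.
have lin3 u v w (s t r : C) (f g h : G -> C) :
    smooth_SU2 f -> smooth_SU2 g -> smooth_SU2 h ->
    cder (pauli u v w) (s *: f + (t *: g + r *: h)) =
    s *: cder (pauli u v w) f + (t *: cder (pauli u v w) g + r *: cder (pauli u v w) h).
  move=> sf sg sh; have sP := su2_pauli u v w.
  rewrite (cderD sP (smoothZ _ sf) (smoothD (smoothZ _ sg) (smoothZ _ sh))).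
  rewrite (cderD sP (smoothZ _ sg) (smoothZ _ sh)).
  by rewrite (cderZ _ sP sf) (cderZ _ sP sg) (cderZ _ sP sh).
have termE k : cder (e k) (cder (e k) c) =
   (a k)%:C *: ((a k)%:C *: d1 (d1 c) + ((x k)%:C *: d1 (d2 c) + (y k)%:C *: d1 (d3 c))) +
   ((x k)%:C *: ((a k)%:C *: d2 (d1 c) + ((x k)%:C *: d2 (d2 c) + (y k)%:C *: d2 (d3 c))) +
    (y k)%:C *: ((a k)%:C *: d3 (d1 c) + ((x k)%:C *: d3 (d2 c) + (y k)%:C *: d3 (d3 c)))).
  rewrite eE (cder_pauli _ _ _ (sd _ _ _ _ sc)) (cder_pauli _ _ _ sc).
  rewrite -/d1 -/d2 -/d3.
  have [s1 s2 s3] : [/\ smooth_SU2 (d1 c), smooth_SU2 (d2 c) & smooth_SU2 (d3 c)].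
    by split; exact: sd.
  by congr (_ + (_ + _)); congr (_ *: _); exact: lin3 s1 s2 s3.
rewrite sum3.
rewrite (termE ord0) (termE i1) (termE i2).
move: (d1 (d1 c)) (d1 (d2 c)) (d1 (d3 c)) (d2 (d1 c)) (d2 (d2 c))
  (d2 (d3 c)) (d3 (d1 c)) (d3 (d2 c)) (d3 (d3 c)) => f11 f12 f13 f21 f22 f23 f31 f32 f33.
move: ((a ord0)%:C) ((a i1)%:C) ((a i2)%:C) ((x ord0)%:C) ((x i1)%:C) ((x i2)%:C)
  ((y ord0)%:C) ((y i1)%:C) ((y i2)%:C) q11 q12 q13 q22 q23 q33.
move=> a0 a1 a2 x0 x1 x2 y0 y1 y2 q11 q12 q13 q22 q23 q33.
apply/funext => g; rewrite !(cfunD, cfunZ).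
move: (f11 g) (f12 g) (f13 g) (f21 g) (f22 g) (f23 g) (f31 g) (f32 g) (f33 g).
move=> s11 s12 s13 s21 s22 s23 s31 s32 s33.
transitivity ((a0 * a0 + (a1 * a1 + a2 * a2)) * s11 +
  (a0 * x0 + (a1 * x1 + a2 * x2)) * (s12 + s21) +
  (a0 * y0 + (a1 * y1 + a2 * y2)) * (s13 + s31) +
  (x0 * x0 + (x1 * x1 + x2 * x2)) * s22 +
  (x0 * y0 + (x1 * y1 + x2 * y2)) * (s23 + s32) +
  (y0 * y0 + (y1 * y1 + y2 * y2)) * s33); first by ring.
by rewrite q11 q12 q13 q22 q23 q33 /=; ring.
Qed.

Definition dZ (E F : M2) c : G -> C := 2^-1 *: (cder E c - 'i%C *: cder F c).
Definition dZbar (E F : M2) c : G -> C := 2^-1 *: (cder E c + 'i%C *: cder F c).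

Lemma smooth_dZ (E F : M2) c : su2 E -> su2 F -> smooth_SU2 c -> smooth_SU2 (dZ E F c).
Proof.
move=> sE sF sc; apply: smoothZ; apply: smoothD; first exact: smooth_cder.
by rewrite -scaleNr; apply: smoothZ; exact: smooth_cder.
Qed.

Lemma smooth_dZbar (E F : M2) c : su2 E -> su2 F -> smooth_SU2 c ->
  smooth_SU2 (dZbar E F c).
Proof.
move=> sE sF sc; apply: smoothZ; apply: smoothD; first exact: smooth_cder.
by apply: smoothZ; exact: smooth_cder.
Qed.

Lemma cder_dZ A (E F : M2) c : su2 A -> su2 E -> su2 F -> smooth_SU2 c ->
  cder A (dZ E F c) = 2^-1 *: (cder A (cder E c) - 'i%C *: cder A (cder F c)).
Proof.
move=> sA sE sF sc; have tE := smooth_cder sE sc; have tF := smooth_cder sF sc.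
rewrite /dZ -!scaleNr (cderZ _ sA (smoothD tE (smoothZ _ tF))).
by rewrite (cderD sA tE (smoothZ _ tF)) (cderZ _ sA tF).
Qed.

Lemma cder_dZbar A (E F : M2) c : su2 A -> su2 E -> su2 F -> smooth_SU2 c ->
  cder A (dZbar E F c) = 2^-1 *: (cder A (cder E c) + 'i%C *: cder A (cder F c)).
Proof.
move=> sA sE sF sc; have tE := smooth_cder sE sc; have tF := smooth_cder sF sc.
rewrite /dZbar (cderZ _ sA (smoothD tE (smoothZ _ tF))).
by rewrite (cderD sA tE (smoothZ _ tF)) (cderZ _ sA tF).
Qed.

Lemma dZ_scale (E F : M2) z c : su2 E -> su2 F -> smooth_SU2 c ->
  dZ E F (z *: c) = z *: dZ E F c.
Proof.
move=> sE sF sc; rewrite /dZ (cderZ _ sE sc) (cderZ _ sF sc).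
move: (cder E c) (cder F c) => u v.
by apply/funext => g; rewrite !(cfunZ, cfunD, cfunN); ring.
Qed.

Lemma dZbar_scale (E F : M2) z c : su2 E -> su2 F -> smooth_SU2 c ->
  dZbar E F (z *: c) = z *: dZbar E F c.
Proof.
move=> sE sF sc; rewrite /dZbar (cderZ _ sE sc) (cderZ _ sF sc).
move: (cder E c) (cder F c) => u v.
by apply/funext => g; rewrite !(cfunZ, cfunD); ring.
Qed.

Lemma dZD (E F : M2) c d : su2 E -> su2 F -> smooth_SU2 c -> smooth_SU2 d ->
  dZ E F (c + d) = dZ E F c + dZ E F d.
Proof.
move=> sE sF sc sd; rewrite /dZ (cderD sE sc sd) (cderD sF sc sd).
move: (cder E c) (cder F c) (cder E d) (cder F d) => u v w z.
by apply/funext => g; rewrite !(cfunZ, cfunD, cfunN); ring.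
Qed.

Lemma dZbarD (E F : M2) c d : su2 E -> su2 F -> smooth_SU2 c -> smooth_SU2 d ->
  dZbar E F (c + d) = dZbar E F c + dZbar E F d.
Proof.
move=> sE sF sc sd; rewrite /dZbar (cderD sE sc sd) (cderD sF sc sd).
move: (cder E c) (cder F c) (cder E d) (cder F d) => u v w z.
by apply/funext => g; rewrite !(cfunZ, cfunD); ring.
Qed.
End Operators.

Section Frame.
Context {R : realType} (p q : R) (pq : 8 * (p ^+ 2 + q ^+ 2) = 1).
Local Notation C := R[i].
Local Notation M2 := 'M[C]_2.
Local Notation G := (SU2 R).
Local Notation E := (pauli 0 p q : M2).
Local Notation F := (pauli 0 (- q) p : M2).
Local Notation T := (pauli 1 0 0 : M2).
Implicit Types (c d : G -> C).
Let sE : su2 E := su2_pauli 0 p q.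
Let sF : su2 F := su2_pauli 0 (- q) p.
Let sT : su2 T := su2_pauli 1 0 0.
Local Hint Resolve sE sF sT : core.

Lemma cder_TE c : smooth_SU2 c -> cder T (cder E c) = cder E (cder T c) + 2 *: cder F c.
Proof.
move=> sc; rewrite (cder_comm sT sE sc); congr (_ + _).
have -> : bracket T E = (2 : R)%:C *: F.
  by rewrite bracket_pauli -pauliZ; congr pauli; ring.
by rewrite (cderZl _ sF sc) rmorph_nat.
Qed.

Lemma cder_TF c : smooth_SU2 c -> cder T (cder F c) = cder F (cder T c) - 2 *: cder E c.
Proof.
move=> sc; rewrite (cder_comm sT sF sc); congr (_ + _).
have -> : bracket T F = (- (2 : R))%:C *: E.
  by rewrite bracket_pauli -pauliZ; congr pauli; ring.
by rewrite (cderZl _ sE sc) rmorphN rmorph_nat scaleNr.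
Qed.

(** The normalization g_0(E, E) = 1 is what fixes the constant 1/4. *)
Lemma cder_EF c : smooth_SU2 c -> cder E (cder F c) = cder F (cder E c) + 4^-1 *: cder T c.
Proof.
move=> sc; rewrite (cder_comm sE sF sc); congr (_ + _).
have -> : bracket E F = (4^-1 : R)%:C *: T.
  rewrite bracket_pauli -pauliZ; congr pauli; [|by ring..].
  by transitivity (4^-1 * (8 * (p ^+ 2 + q ^+ 2))); [field | rewrite pq].
by rewrite (cderZl _ sT sc) fmorphV rmorph_nat.
Qed.

Let ii : 'i%C * 'i%C = -1 :> C.
Proof. by rewrite -expr2 sqr_i. Qed.

Lemma cder_T_dZ c : smooth_SU2 c ->
  cder T (dZ E F c) = dZ E F (cder T c) + (2 * 'i%C) *: dZ E F c.
Proof.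
move=> sc; rewrite cder_dZ// cder_TE// cder_TF//.
rewrite /dZ; move: (cder E (cder T c)) (cder F (cder T c)) (cder E c) (cder F c) => u v w z.
apply/funext => g; rewrite !(cfunZ, cfunD, cfunN).
(* The two sides agree only modulo i^2 = -1, so their difference is exhibited
   as a multiple of i^2 + 1. *)
apply/subr0_eq; transitivity (('i%C * 'i%C + 1) * z g); first by field.
by rewrite ii addNr mul0r.
Qed.

Lemma cder_T_dZbar c : smooth_SU2 c ->
  cder T (dZbar E F c) = dZbar E F (cder T c) - (2 * 'i%C) *: dZbar E F c.
Proof.
move=> sc; rewrite cder_dZbar// cder_TE// cder_TF//.
rewrite /dZbar; move: (cder E (cder T c)) (cder F (cder T c)) (cder E c) (cder F c) => u v w z.
apply/funext => g; rewrite !(cfunZ, cfunD, cfunN).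
apply/subr0_eq; transitivity (('i%C * 'i%C + 1) * z g); first by field.
by rewrite ii addNr mul0r.
Qed.

Lemma dZ_dZbar c : smooth_SU2 c ->
  dZ E F (dZbar E F c) = dZbar E F (dZ E F c) + ('i%C / 8) *: cder T c.
Proof.
move=> sc; rewrite [LHS]/dZ [dZbar E F (dZ E F c)]/dZbar !cder_dZ// !cder_dZbar// cder_EF//.
move: (cder E (cder E c)) (cder F (cder E c)) (cder F (cder F c)) (cder T c) => u v w z.
by apply/funext => g; rewrite !(cfunZ, cfunD, cfunN); field.
Qed.

(** Both sides come from the orthonormal basis formed by E, F and a multiple of
    the torus generator; 2 (Z Zbar + Zbar Z) = E^2 + F^2. *)
Lemma casimir_dZ (e : 'I_3 -> M2) c : su2_onb e -> smooth_SU2 c ->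
  \sum_(k < 3) cder (e k) (cder (e k) c) =
  2 *: (dZ E F (dZbar E F c) + dZbar E F (dZ E F c)) + 8^-1 *: cder T (cder T c).
Proof.
move=> oe sc; rewrite (casimir_cder oe sc).
have sd u v w : smooth_SU2 (cder (pauli u v w) c).
  by exact: smooth_cder (su2_pauli _ _ _) sc.
have -> : dZ E F (dZbar E F c) + dZbar E F (dZ E F c) =
    2^-1 *: (cder E (cder E c) + cder F (cder F c)).
  rewrite [dZ E F (dZbar E F c)]/dZ [dZbar E F (dZ E F c)]/dZbar !cder_dZ// !cder_dZbar//.
  move: (cder E (cder E c)) (cder E (cder F c)) (cder F (cder E c)) (cder F (cder F c)) => u v w z.
  apply/funext => g; rewrite !(cfunZ, cfunD, cfunN).
  apply/subr0_eq; transitivity (- (2^-1 * z g) * ('i%C * 'i%C + 1)); first by field.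
  by rewrite ii addNr mulr0.
have lin (x y : R) u v : smooth_SU2 u -> smooth_SU2 v -> forall A, su2 A ->
    cder A (x%:C *: u + y%:C *: v) = x%:C *: cder A u + y%:C *: cder A v.
  move=> su sv A sA; rewrite (cderD sA (smoothZ _ su) (smoothZ _ sv)).
  by rewrite (cderZ _ sA su) (cderZ _ sA sv).
have EE d : smooth_SU2 d -> cder E d = p%:C *: cder (pauli 0 1 0) d + q%:C *: cder (pauli 0 0 1) d.
  by move=> sd'; rewrite (cder_pauli 0 p q sd') scale0r add0r.
have FE d : smooth_SU2 d -> cder F d = (- q)%:C *: cder (pauli 0 1 0) d + p%:C *: cder (pauli 0 0 1) d.
  by move=> sd'; rewrite (cder_pauli 0 (- q) p sd') scale0r add0r.
rewrite (EE _ (smooth_cder sE sc)) (FE _ (smooth_cder sF sc)) (EE _ sc) (FE _ sc).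
have s2 := su2_pauli (0:R) 1 0; have s3 := su2_pauli (0:R) 0 1.
rewrite !(lin _ _ _ _ (sd _ _ _) (sd _ _ _) _ s2) !(lin _ _ _ _ (sd _ _ _) (sd _ _ _) _ s3).
have pqC : 8 * (p%:C ^+ 2 + q%:C ^+ 2) = 1 :> C.
  by rewrite -!rmorphXn -rmorphD -(rmorph_nat (real_complex R)) -rmorphM pq.
have -> : (- q)%:C = - q%:C :> C by rewrite rmorphN.
move: p%:C q%:C pqC => P Q PQ.
move: (cder (pauli 1 0 0) (cder (pauli 1 0 0) c)) => s11.
move: (cder (pauli 0 1 0) (cder (pauli 0 0 1) c)) => s23.
move: (cder (pauli 0 0 1) (cder (pauli 0 1 0) c)) => s32.
move: (cder (pauli 0 1 0) (cder (pauli 0 1 0) c)) => s22.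
move: (cder (pauli 0 0 1) (cder (pauli 0 0 1) c)) => s33.
apply/funext => g; rewrite !(cfunZ, cfunD).
apply/subr0_eq; transitivity (8^-1 * (1 - 8 * (P ^+ 2 + Q ^+ 2)) * (s22 g + s33 g)).
  by field.
by rewrite PQ subrr mulr0 mul0r.
Qed.
End Frame.

(** * Infinitesimal equivariance of sections *)

Section Weight.
Context {R : realType}.
Local Notation C := R[i].
Local Notation M2 := 'M[C]_2.
Local Notation G := (SU2 R).
Local Notation T := (pauli 1 0 0 : M2).

(** The powers of exp(- i t), to first order at t = 0. *)
Lemma is_derive_rotX (cs sn : R -> R) k :
  is_derive (0:R) (1:R) cs 0 -> is_derive (0:R) (1:R) sn 1 -> cs 0 = 1 -> sn 0 = 0 ->
  [/\ is_derive (0:R) (1:R) (fun t => complex.Re ((cs t -i* sn t) ^+ k)) 0,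
      is_derive (0:R) (1:R) (fun t => complex.Im ((cs t -i* sn t) ^+ k)) (- k%:R) &
      (cs 0 -i* sn 0) ^+ k = 1 :> C].
Proof.
move=> dc ds c0 s0.
have u0 : cs 0 -i* sn 0 = 1 :> C by rewrite c0 s0 oppr0.
elim: k => [|k [dR dI e]]; first by split=> //; rewrite ?oppr0; exact: is_derive_cst.
pose a t := complex.Re ((cs t -i* sn t) ^+ k); pose b t := complex.Im ((cs t -i* sn t) ^+ k).
have a0 : a 0 = 1 by rewrite /a e.
have b0 : b 0 = 0 by rewrite /b e.
split; last by rewrite exprS e u0 mulr1.
- have -> : (fun t => complex.Re ((cs t -i* sn t) ^+ k.+1)) = cs * a + sn * b.
    apply/funext => t; rewrite exprS -[RHS]/(cs t * a t + sn t * b t) /a /b.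
    by case: (_ ^+ k) => u v /=; ring.
  apply: (is_derive_eq (is_deriveD (is_deriveM dc dR) (is_deriveM ds dI))).
  by rewrite -/(a 0) -/(b 0) c0 s0 a0 b0 /GRing.scale /=; ring.
- have -> : (fun t => complex.Im ((cs t -i* sn t) ^+ k.+1)) = cs * b - sn * a.
    apply/funext => t; rewrite exprS -[RHS]/(cs t * b t - sn t * a t) /a /b.
    by case: (_ ^+ k) => u v /=; ring.
  apply: (is_derive_eq (is_deriveB (is_deriveM dc dI) (is_deriveM ds dR))).
  by rewrite -/(a 0) -/(b 0) c0 s0 a0 b0 /GRing.scale /= -[k.+1%:R]natr1; ring.
Qed.

Lemma Cderive_rotX (cs sn : R -> R) k (z : C) :
  is_derive (0:R) (1:R) cs 0 -> is_derive (0:R) (1:R) sn 1 -> cs 0 = 1 -> sn 0 = 0 ->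
  Cderive (fun t => (cs t -i* sn t) ^+ k * z) 0 = - (k%:R * 'i%C) * z.
Proof.
move=> dc ds c0 s0; have [dR dI _] := is_derive_rotX k dc ds c0 s0.
have lin (x y : R) (f : R -> R) :
    f = x *: (fun t => complex.Re ((cs t -i* sn t) ^+ k))
        + y *: (fun t => complex.Im ((cs t -i* sn t) ^+ k)) ->
    derive1 f 0 = - (k%:R * y).
  move=> ->; rewrite derive1E.
  apply: (etrans (@derive_val _ _ _ _ _ _ _ (is_deriveD (is_deriveZ x dR) (is_deriveZ y dI)))).
  by rewrite /GRing.scale /=; ring.
rewrite /Cderive.
rewrite (lin (complex.Re z) (- complex.Im z)); last first.
  apply/funext => t; rewrite /= -[RHS]/(complex.Re z * complex.Re ((cs t -i* sn t) ^+ k) +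
    - complex.Im z * complex.Im ((cs t -i* sn t) ^+ k)).
  by case: (_ ^+ k) z => [u v] [x y] /=; ring.
rewrite (lin (complex.Im z) (complex.Re z)); last first.
  apply/funext => t; rewrite /= -[RHS]/(complex.Im z * complex.Re ((cs t -i* sn t) ^+ k) +
    complex.Re z * complex.Im ((cs t -i* sn t) ^+ k)).
  by case: (_ ^+ k) z => [u v] [x y] /=; ring.
have -> : (k%:R : C) = (k%:R : R)%:C by rewrite rmorph_nat.
by case: z => x y; simpc; congr (_ +i* _); ring.
Qed.

(** Differentiate c (g exp(t T)) = exp(- i (2 l + 1) t) c g at t = 0. The
    equivariance of psi passes to c at a point where h_l does not vanish. *)
Lemma section_weight l (psi : spinor R) (c : G -> C) :
  (forall g, psi g = fun x => c g * (hermite l x)%:C) ->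
  (forall g t, torus t -> psi (g * t)%g = torus_act l t^-1%g (psi g)) ->
  cder T c = - ((2 * l + 1)%:R * 'i%C) *: c.
Proof.
move=> psiE equiv; have [cs [sn [dc ds c0 s0 expE]]] := expSU2_line (su2_pauli (1:R) 0 0).
have [x hx] := hermite_neq0 (R := R) l.
apply/funext => g; rewrite cderE -[RHS]/(- ((2 * l + 1)%:R * 'i%C) * c g).
rewrite -(Cderive_rotX _ _ dc ds c0 s0); congr (Cderive _ 0); apply/funext => t.
set h := expSU2 _.
have tor : torus h.
  apply/is_diag_mxP => i j; rewrite expE !mxE.
  by case: (ord2P i) => ->; case: (ord2P j) => -> //= _; rewrite pauliE ?oppr0; simpc.
have h00 : SU2_mx (h^-1)%g 0 0 = cs t -i* sn t.
  rewrite -[SU2_mx (h^-1)%g]/((SU2_mx h)^t*) expE !mxE pauliE conjC_conjc.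
  by simpc.
have := congr1 (fun f => f x) (equiv g h tor).
rewrite !psiE /torus_act h00.
rewrite -[RHS]/((cs t -i* sn t) ^+ (2 * l + 1) * (c g * (hermite l x)%:C)) mulrA.
apply: mulIf; rewrite -(rmorph0 (real_complex R)).
by apply/negP => /eqP/complexI/eqP; rewrite (negbTE hx).
Qed.
End Weight.

Section Weights.
Context {R : realType} (p q : R) (pq : 8 * (p ^+ 2 + q ^+ 2) = 1).
Local Notation C := R[i].
Local Notation M2 := 'M[C]_2.
Local Notation G := (SU2 R).
Local Notation E := (pauli 0 p q : M2).
Local Notation F := (pauli 0 (- q) p : M2).
Local Notation T := (pauli 1 0 0 : M2).
Local Notation a := (dZ E F).
Local Notation b := (dZbar E F).
Implicit Types (c d : G -> C) (w k z : C).
Let sE : su2 E := su2_pauli 0 p q.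
Let sF : su2 F := su2_pauli 0 (- q) p.
Let sT : su2 T := su2_pauli 1 0 0.

(** For w = 2 l + 1 this is the infinitesimal form of the equivariance that
    defines sections of E_l. *)
Definition weight w c := cder T c = - (w * 'i%C) *: c.

Let ii : 'i%C * 'i%C = -1 :> C.
Proof. by rewrite -expr2 sqr_i. Qed.

(** Z is a root vector, so deriving along it shifts the weight. *)
Lemma weight_dZ w c : smooth_SU2 c -> weight w c -> weight (w - 2) (a c).
Proof.
move=> sc wc; rewrite /weight (cder_T_dZ p q sc) wc (dZ_scale _ sE sF sc).
by move: (a c) => u; apply/funext => g; rewrite !(cfunD, cfunZ); ring.
Qed.

Lemma weight_dZbar w c : smooth_SU2 c -> weight w c -> weight (w + 2) (b c).
Proof.
move=> sc wc; rewrite /weight (cder_T_dZbar p q sc) wc (dZbar_scale _ sE sF sc).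
by move: (b c) => u; apply/funext => g; rewrite !(cfunD, cfunZ, cfunN); ring.
Qed.

Lemma dZ_dZbar_weight w c : smooth_SU2 c -> weight w c ->
  a (b c) = b (a c) + (w / 8) *: c.
Proof.
move=> sc wc; rewrite (dZ_dZbar pq sc) wc; congr (_ + _).
apply/funext => g; rewrite !cfunZ; apply/subr0_eq.
by transitivity (- (w / 8 * c g) * ('i%C * 'i%C + 1)); [field | rewrite ii addNr mulr0].
Qed.

(** The action of P on the coefficient of a spinor in E_k. The integer k is
    replaced by a scalar, so that no truncated subtraction occurs in the
    commutation relations. *)
Definition coefP k c : G -> C := (4 * k) *: b (a c) - (4 * (k + 1)) *: a (b c).

Lemma coefP_casimir (e : 'I_3 -> M2) k c : su2_onb e -> smooth_SU2 c ->
  weight (2 * k + 1) c ->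
  coefP k c = - \sum_(j < 3) cder (e j) (cder (e j) c)
              - (3 / 2) *: (- (k + 1 / 2) *: (- (k + 1 / 2) *: c)).
Proof.
move=> oe sc wc; rewrite (casimir_dZ pq oe sc) /coefP (dZ_dZbar_weight sc wc).
rewrite wc (cderZ _ sT sc) wc; move: (b (a c)) => u.
apply/funext => g; rewrite !(cfunD, cfunN, cfunZ); apply/subr0_eq.
transitivity ((2 * k + 1) ^+ 2 / 8 * c g * ('i%C * 'i%C + 1)); first by field.
by rewrite ii addNr mulr0.
Qed.

Lemma coefP_scale k z c : smooth_SU2 c -> coefP k (z *: c) = z *: coefP k c.
Proof.
move=> sc; rewrite /coefP (dZ_scale _ sE sF sc) (dZbar_scale _ sE sF sc).
rewrite (dZ_scale _ sE sF (smooth_dZbar sE sF sc)).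
rewrite (dZbar_scale _ sE sF (smooth_dZ sE sF sc)).
move: (a (b c)) (b (a c)) => u v.
by apply/funext => g; rewrite !(cfunD, cfunN, cfunZ); ring.
Qed.

(** Once each b is moved to the left of each a, the third-order terms
    cancel. *)
Lemma coefP_dZ k c : smooth_SU2 c -> weight (2 * k + 1) c ->
  coefP (k - 1) (a c) = a (coefP k c) + (3 * k) *: a c.
Proof.
move=> sc wc; have sa := smooth_dZ sE sF sc; have sb := smooth_dZbar sE sF sc.
have sba := smooth_dZbar sE sF sa; have sab := smooth_dZ sE sF sb.
have wa := weight_dZ sc wc.
have e1 := dZ_dZbar_weight sa wa.
rewrite /coefP -[in RHS]scaleNr (dZD sE sF (smoothZ _ sba) (smoothZ _ sab)).
rewrite (dZ_scale _ sE sF sba) (dZ_scale _ sE sF sab) (dZ_dZbar_weight sc wc).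
rewrite (dZD sE sF sba (smoothZ _ sc)) (dZ_scale _ sE sF sc) e1.
move: (b (a (a c))) (a c) => u v.
by apply/funext => g; rewrite !(cfunD, cfunN, cfunZ); field.
Qed.

Lemma coefP_dZbar k c : smooth_SU2 c -> weight (2 * k + 1) c ->
  coefP (k + 1) (b c) = b (coefP k c) - (3 * (k + 1)) *: b c.
Proof.
move=> sc wc; have sa := smooth_dZ sE sF sc; have sb := smooth_dZbar sE sF sc.
have sba := smooth_dZbar sE sF sa; have sab := smooth_dZ sE sF sb.
have wb := weight_dZbar sc wc.
rewrite /coefP -[in RHS]scaleNr (dZbarD sE sF (smoothZ _ sba) (smoothZ _ sab)).
rewrite (dZbar_scale _ sE sF sba) (dZbar_scale _ sE sF sab).
rewrite (dZ_dZbar_weight sb wb) (dZ_dZbar_weight sc wc).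
rewrite (dZbarD sE sF sba (smoothZ _ sc)) (dZbar_scale _ sE sF sc).
move: (b (b (a c))) (b c) => u v.
by apply/funext => g; rewrite !(cfunD, cfunN, cfunZ); field.
Qed.
End Weights.

(** * Operators on spinors in Hermite coordinates *)

Section Spin.
Context {R : realType}.
Local Notation C := R[i].
Local Notation M2 := 'M[C]_2.
Local Notation G := (SU2 R).
Implicit Types (n : nat) (m : nat -> nat) (c d : nat -> G -> C).

(** A finite sum of decomposable spinors. The Hermite indices are given by a
    function m, so that raising and lowering operators only modify m and the
    coefficients c. *)
Definition spin n m c : spinor R := fun g x =>
  \sum_(l < n) c l g * (hermite (m l) x)%:C.

(** The Hermite index of a term is irrelevant when its coefficient vanishes; this
    absorbs the truncated predecessor at index 0. *)
Lemma spin_eq n m m' c d :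
  (forall l, c l = d l /\ (m l = m' l \/ c l = 0)) -> spin n m c = spin n m' d.
Proof.
move=> h; apply/funext => g; apply/funext => x; apply: eq_bigr => l _.
by have [<- [->//|->]] := h l; rewrite !mul0r.
Qed.

Lemma spinD n m c d : spin n m c + spin n m d = spin n m (fun l => c l + d l).
Proof.
apply/funext => g; apply/funext => x; rewrite -[LHS]/(spin n m c g x + spin n m d g x).
rewrite -big_split; apply: eq_bigr => l _; exact: esym (mulrDl _ _ _).
Qed.

Lemma spinZ n m (z : C) c : z *: spin n m c = spin n m (fun l => z *: c l).
Proof.
apply/funext => g; apply/funext => x; rewrite -[LHS]/(z * spin n m c g x).
rewrite mulr_sumr; apply: eq_bigr => l _; exact: mulrA.
Qed.

Lemma spinN n m c : - spin n m c = spin n m (fun l => - c l).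
Proof.
apply/funext => g; apply/funext => x; rewrite -[LHS]/(- spin n m c g x).
rewrite -sumrN; apply: eq_bigr => l _; exact: esym (mulNr _ _).
Qed.

Lemma left_der_spin n m c A : su2 A -> (forall l, smooth_SU2 (c l)) ->
  left_der A (spin n m c) = spin n m (fun l => cder A (c l)).
Proof.
move=> sA sc; apply/funext => g; apply/funext => x.
rewrite /left_der -(cderE A (fun h => spin n m c h x)).
have -> : (fun h => spin n m c h x) = \sum_(l < n) (hermite (m l) x)%:C *: c l.
  by apply/funext => h; rewrite fct_sumE; apply: eq_bigr => l _; rewrite mulrC.
rewrite (cder_sum n (fun l => (hermite (m l) x)%:C) sA sc) fct_sumE.
by apply: eq_bigr => l _; rewrite mulrC.
Qed.

(** For Z = (E - i F) / 2 the complex-linear extension splits Z into the parts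
    E / 2 and - F / 2 in su(2). *)
Lemma lder_vZ n m c (E F : M2) : su2 E -> su2 F -> (forall l, smooth_SU2 (c l)) ->
  lder (vZ E F) (spin n m c) = spin n m (fun l => dZ E F (c l)).
Proof.
move=> sE sF sc; have i0 : ('i%C : C) != 0 by rewrite eq_complex /= oner_eq0 andbF.
have half : (2^-1 : R)%:C = 2^-1 :> C by rewrite fmorphV rmorph_nat.
have halfN : (- 2^-1 : R)%:C = - 2^-1 :> C by rewrite rmorphN /= half.
have conj1 (u v : C) : conjc (2^-1 * (u - 'i%C * v)) = 2^-1 * (conjc u + 'i%C * conjc v).
  by rewrite -half; case: u v => [x y] [z t]; rewrite /conjc /=; simpc; congr (_ +i* _); ring.
have e1 : 2^-1 *: (vZ E F - (vZ E F)^t*) = (2^-1 : R)%:C *: E.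
  by apply/matrixP => r s; rewrite half !mxE conjC_conjc conj1 !su2_conj//; field.
have e2 : (2 * 'i%C)^-1 *: (vZ E F + (vZ E F)^t*) = (- 2^-1 : R)%:C *: F.
  apply/matrixP => r s; rewrite halfN !mxE conjC_conjc conj1 !su2_conj//.
  by field.
apply/funext => g; apply/funext => x.
rewrite /lder e1 e2 !left_der_spin ?su2Z//.
rewrite -[RHS]/(spin n m _ g x) /spin mulr_sumr -big_split /=; apply: eq_bigr => l _.
rewrite (cderZl _ sE (sc l)) (cderZl _ sF (sc l)) halfN half /dZ.
move: (cder E (c l)) (cder F (c l)) => u v.
by rewrite !(cfunD, cfunN, cfunZ); ring.
Qed.

Lemma lder_vZbar n m c (E F : M2) : su2 E -> su2 F -> (forall l, smooth_SU2 (c l)) ->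
  lder (vZbar E F) (spin n m c) = spin n m (fun l => dZbar E F (c l)).
Proof.
move=> sE sF sc; have i0 : ('i%C : C) != 0 by rewrite eq_complex /= oner_eq0 andbF.
have half : (2^-1 : R)%:C = 2^-1 :> C by rewrite fmorphV rmorph_nat.
have conj1 (u v : C) : conjc (2^-1 * (u + 'i%C * v)) = 2^-1 * (conjc u - 'i%C * conjc v).
  by rewrite -half; case: u v => [x y] [z t]; rewrite /conjc /=; simpc; congr (_ +i* _); ring.
have e1 : 2^-1 *: (vZbar E F - (vZbar E F)^t*) = (2^-1 : R)%:C *: E.
  by apply/matrixP => r s; rewrite half !mxE conjC_conjc conj1 !su2_conj//; field.
have e2 : (2 * 'i%C)^-1 *: (vZbar E F + (vZbar E F)^t*) = (2^-1 : R)%:C *: F.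
  apply/matrixP => r s; rewrite half !mxE conjC_conjc conj1 !su2_conj//.
  by field.
apply/funext => g; apply/funext => x.
rewrite /lder e1 e2 !left_der_spin ?su2Z//.
rewrite -[RHS]/(spin n m _ g x) /spin mulr_sumr -big_split /=; apply: eq_bigr => l _.
rewrite (cderZl _ sE (sc l)) (cderZl _ sF (sc l)) half /dZbar.
move: (cder E (c l)) (cder F (c l)) => u v.
by rewrite !(cfunD, cfunN, cfunZ); ring.
Qed.

Lemma casimir_spin n m c (e : 'I_3 -> M2) : su2_onb e -> (forall l, smooth_SU2 (c l)) ->
  casimir e (spin n m c) =
  spin n m (fun l => \sum_(k < 3) cder (e k) (cder (e k) (c l))).
Proof.
move=> [se _] sc.
have dd k : left_der (e k) (left_der (e k) (spin n m c)) =
    spin n m (fun l => cder (e k) (cder (e k) (c l))).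
  rewrite (left_der_spin n m (se k) sc) left_der_spin// => l.
  exact: smooth_cder.
rewrite /casimir (sum3E (fun k => left_der (e k) (left_der (e k) (spin n m c)))).
rewrite (dd ord0) (dd (inord 1)) (dd (inord 2)) !spinD.
congr (spin n m); apply/funext => l.
by rewrite (sum3E (fun k => cder (e k) (cder (e k) (c l)))).
Qed.

Lemma Cderive_spin n m c g x : Cderive (spin n m c g) x =
  \sum_(l < n) c l g * (x * hermite (m l) x + hermite (m l).+1 x)%:C.
Proof.
exact: (@Cderive_sum _ n (fun l => hermite (m l))
  (fun l x => x * hermite (m l) x + hermite (m l).+1 x) (fun l => c l g) x
  (fun l => is_derive_hermite (m l) x)).
Qed.

Lemma g0_vZ (E F B : M2) : su2 E -> su2 F -> su2 B ->
  g0 (vZ E F) B = 2^-1 * (g0 E B - 'i%C * g0 F B).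
Proof.
move=> sE sF sB; have [tE tF tB] := And3 (su2_tr sE) (su2_tr sF) (su2_tr sB).
rewrite /g0 !killing_tr// /vZ; last by rewrite !mxE tE tF; ring.
by rewrite -scalemxAl mulmxBl -scalemxAl mxtraceZ raddfB /= mxtraceZ; ring.
Qed.

Lemma g0_vZbar (E F B : M2) : su2 E -> su2 F -> su2 B ->
  g0 (vZbar E F) B = 2^-1 * (g0 E B + 'i%C * g0 F B).
Proof.
move=> sE sF sB; have [tE tF tB] := And3 (su2_tr sE) (su2_tr sF) (su2_tr sB).
rewrite /g0 !killing_tr// /vZbar; last by rewrite !mxE tE tF; ring.
by rewrite -scalemxAl mulmxDl -scalemxAl mxtraceZ mxtraceD mxtraceZ; ring.
Qed.

Lemma realCD (x y : R) : (x + y)%:C = x%:C + y%:C :> C. Proof. exact: rmorphD. Qed.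
Lemma realCN (x : R) : (- x)%:C = - x%:C :> C. Proof. exact: rmorphN. Qed.
Lemma realCM (x y : R) : (x * y)%:C = x%:C * y%:C :> C. Proof. exact: rmorphM. Qed.
Lemma realCX (x : R) k : (x ^+ k)%:C = x%:C ^+ k :> C. Proof. exact: rmorphXn. Qed.
Lemma realC1 : (1 : R)%:C = 1 :> C. Proof. by []. Qed.
Lemma realCn k : (k%:R)%:C = k%:R :> C. Proof. exact: rmorph_nat. Qed.
End Spin.

Section DolbeaultOnSpin.
Context {R : realType} (p q : R) (pq : 8 * (p ^+ 2 + q ^+ 2) = 1).
Local Notation C := R[i].
Local Notation M2 := 'M[C]_2.
Local Notation G := (SU2 R).
Local Notation E := (pauli 0 p q : M2).
Local Notation F := (pauli 0 (- q) p : M2).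
Local Notation a := (dZ E F).
Local Notation b := (dZbar E F).
Implicit Types (n : nat) (m : nat -> nat) (c d : nat -> G -> C).
Let sE : su2 E := su2_pauli 0 p q.
Let sF : su2 F := su2_pauli 0 (- q) p.

Let ii : 'i%C * 'i%C = -1 :> C.
Proof. by rewrite -expr2 sqr_i. Qed.

Lemma frame_g0 : (g0 E E = 1) * (g0 E F = 0) * (g0 F E = 0) * (g0 F F = 1).
Proof.
have nE : 8 * (0 * 0 + p * p + q * q) = 1 by rewrite -[RHS]pq; ring.
have nF : 8 * (0 * 0 + - q * - q + p * p) = 1 by rewrite -[RHS]pq; ring.
have nEF : 8 * (0 * 0 + p * - q + q * p) = 0 :> R by ring.
have nFE : 8 * (0 * 0 + - q * p + p * q) = 0 :> R by ring.
by do !split; rewrite g0_pauli ?nE ?nF ?nEF ?nFE.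
Qed.

Lemma sigma_vZbar_spin n m c g :
  sigma E F (vZbar E F) (spin n m c g) =
  spin n (fun l => (m l).-1) (fun l => - ('i%C * (m l)%:R) *: c l) g.
Proof.
apply/funext => x; rewrite /sigma !g0_vZbar// !frame_g0 Cderive_spin /spin.
rewrite !mulr_sumr -big_split /=; apply: eq_bigr => l _.
rewrite hermite_rec cfunZ !(realCD, realCN, realCM, realCn).
by field.
Qed.

Lemma sigma_vZ_spin n m c g :
  sigma E F (vZ E F) (spin n m c g) =
  spin n (fun l => (m l).+1) (fun l => - ('i%C / 2) *: c l) g.
Proof.
apply/funext => x; rewrite /sigma !g0_vZ// !frame_g0 Cderive_spin /spin.
rewrite !mulr_sumr -big_split /=; apply: eq_bigr => l _.
rewrite cfunZ !(realCD, realCN, realCM, realCn).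
by field.
Qed.

Lemma dolbeault_spin n m c : (forall l, smooth_SU2 (c l)) ->
  dolbeault E F (spin n m c) =
  spin n (fun l => (m l).-1) (fun l => (4 * (m l)%:R) *: a (c l)).
Proof.
move=> sc; apply/funext => g; rewrite /dolbeault (lder_vZ n m sE sF sc).
rewrite sigma_vZbar_spin; apply/funext => x.
rewrite -[LHS]/(4 * 'i%C * spin n _ _ g x) /spin mulr_sumr; apply: eq_bigr => l _.
rewrite !cfunZ; move: (a (c l) g) => u; apply/subr0_eq.
transitivity (- (4 * (m l)%:R * u * (hermite (m l).-1 x)%:C) * ('i%C * 'i%C + 1)).
  by ring.
by rewrite ii addNr mulr0.
Qed.

Lemma dolbeault_bar_spin n m c : (forall l, smooth_SU2 (c l)) ->
  dolbeault_bar E F (spin n m c) =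
  spin n (fun l => (m l).+1) (fun l => (- 2) *: b (c l)).
Proof.
move=> sc; apply/funext => g; rewrite /dolbeault_bar (lder_vZbar n m sE sF sc).
rewrite sigma_vZ_spin; apply/funext => x.
rewrite -[LHS]/(- (4 * 'i%C) * spin n _ _ g x) /spin mulr_sumr; apply: eq_bigr => l _.
rewrite !cfunZ; move: (b (c l) g) => u; apply/subr0_eq.
transitivity (2 * u * (hermite (m l).+1 x)%:C * ('i%C * 'i%C + 1)).
  by field.
by rewrite ii addNr mulr0.
Qed.

Lemma opH_spin n m c :
  opH E F (spin n m c) = spin n m (fun l => - ((m l)%:R + 1 / 2) *: c l).
Proof.
have sgE (f : R -> C) : sigma E F E f = fun x => 'i%C * x%:C * f x.
  by apply/funext => x; rewrite /sigma !frame_g0; ring.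
have sgF (f : R -> C) : sigma E F F f = Cderive f.
  by apply/funext => x; rewrite /sigma !frame_g0; ring.
apply/funext => g; apply/funext => x; rewrite /opH !sgE !sgF.
have -> : Cderive (spin n m c g) = fun y =>
    \sum_(l < n) c l g * (y * hermite (m l) y + hermite (m l).+1 y)%:C.
  by apply/funext => y; exact: Cderive_spin.
rewrite -[LHS]/(2^-1 * ('i%C * x%:C * ('i%C * x%:C * spin n m c g x) + _)).
rewrite (@Cderive_sum _ n (fun l y => y * hermite (m l) y + hermite (m l).+1 y)
  (fun l y => (y ^+ 2 - 2 * (m l)%:R - 1) * hermite (m l) y) (fun l => c l g) x
  (fun l => is_derive2_hermite (m l) x)).
rewrite /spin !mulr_sumr -big_split mulr_sumr /=; apply: eq_bigr => l _.
rewrite cfunZ; move: (hermite (m l) x) (c l g) => v u.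
rewrite !(realCD, realCN, realCM, realCX, realCn) realC1; apply/subr0_eq.
transitivity (2^-1 * x%:C ^+ 2 * u * v%:C * ('i%C * 'i%C + 1)); first by field.
by rewrite ii addNr mulr0.
Qed.

(** Lowering and raising again returns to the index m, except at m = 0, where
    lowering already gives zero. *)
Lemma opP_spin n m c : (forall l, smooth_SU2 (c l)) ->
  opP E F (spin n m c) = spin n m (fun l => coefP p q (m l)%:R (c l)).
Proof.
move=> sc; have sa l := smooth_dZ sE sF (sc l); have sb l := smooth_dZbar sE sF (sc l).
rewrite /opP /commutator (dolbeault_bar_spin _ _ sc) (dolbeault_spin _ _ sc).
rewrite (dolbeault_spin _ _ (fun l => smoothZ _ (sb l))).
rewrite (dolbeault_bar_spin _ _ (fun l => smoothZ _ (sa l))).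
have -> : spin n (fun l => (m l).-1.+1) (fun l => - 2 *: b ((4 * (m l)%:R) *: a (c l))) =
          spin n m (fun l => (- 2 * (4 * (m l)%:R)) *: b (a (c l))).
  apply: spin_eq => l; rewrite (dZbar_scale _ sE sF (sa l)) scalerA; split => //.
  by case: (m l) => [|k]; [right; rewrite !mulr0 scale0r | left].
rewrite spinN spinD spinZ; congr (spin n m); apply/funext => l.
rewrite /coefP (dZ_scale _ sE sF (sb l)) -[_.+1%:R]natr1.
move: (a (b (c l))) (b (a (c l))) => u v.
by apply/funext => g; rewrite !(cfunD, cfunN, cfunZ); field.
Qed.
End DolbeaultOnSpin.

Lemma section_Sm_spin (R : realType) (phi : spinor R) : section_Sm phi ->
  exists n (c : nat -> SU2 R -> R[i]), [/\ forall l, smooth_SU2 (c l),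
    forall l, weight (2 * l%:R + 1) (c l) & phi = spin n id c].
Proof.
move=> [n [psi [psiP ->]]].
have /choice[c cP] : forall l, exists c : SU2 R -> R[i],
    smooth_SU2 c /\ forall g, psi l g = fun x => c g * (hermite l x)%:C.
  by move=> l; have [[c sc cE] _] := psiP l; exists c.
exists n, c; split=> [l|l|].
- by have [] := cP l.
- have [_ equiv] := psiP l; have [_ cE] := cP l.
  by rewrite /weight (section_weight cE equiv) natrD natrM.
- apply/funext => g; apply/funext => x; rewrite !fct_sumE; apply: eq_bigr => l _.
  by have [_ ->] := cP l.
Qed.

Theorem proposition5p3 (R : realType) (E F : 'M[R[i]%C]_2)
    (e : 'I_3 -> 'M[R[i]%C]_2) (phi : spinor R) :
  adapted_frame E F -> su2_onb e -> section_Sm phi ->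
  [/\ opP E F phi = - casimir e phi - (3 / 2) *: opH E F (opH E F phi),
      commutator (opP E F) (dolbeault E F) phi =
        - 3 *: dolbeault E F (opH E F phi) - (3 / 2) *: dolbeault E F phi &
      commutator (opP E F) (dolbeault_bar E F) phi =
        3 *: dolbeault_bar E F (opH E F phi) - (3 / 2) *: dolbeault_bar E F phi].
Proof.
move=> /adapted_frame_pauli[p [q [-> -> pq]]] oe /section_Sm_spin[n [c [sc wc ->]]].
have sE := su2_pauli 0 p q; have sF := su2_pauli 0 (- q) p.
have sa l := smooth_dZ sE sF (sc l); have sb l := smooth_dZbar sE sF (sc l).
have sP k l : smooth_SU2 (coefP p q k (c l)).
  rewrite /coefP -scaleNr; apply: smoothD; apply: smoothZ.
    exact: smooth_dZbar.
  exact: smooth_dZ.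
have PE d : (forall l, smooth_SU2 (d l)) -> forall m,
    opP (pauli 0 p q) (pauli 0 (- q) p) (spin n m d) = spin n m (fun l => coefP p q (m l)%:R (d l)).
  by move=> sd m; exact: opP_spin.
split.
- rewrite PE// casimir_spin// !(opH_spin pq) spinZ !spinN spinD.
  congr (spin n id); apply/funext => l.
  exact: coefP_casimir.
- rewrite /commutator (dolbeault_spin pq _ _ sc) PE; last by move=> l; exact: smoothZ.
  rewrite PE// (dolbeault_spin pq _ _ (fun l => sP _ l)) (opH_spin pq).
  rewrite (dolbeault_spin pq _ _ (fun l => smoothZ _ (sc l))).
  rewrite !spinZ !spinN !spinD; apply: spin_eq => l; split; last by left.
  rewrite (coefP_scale _ _ _ _ (sa l)) (dZ_scale _ sE sF (sc l)).
  (* At l = 0 both sides carry the factor l of D. *)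
  have [l0|l0] := posnP l.
    by rewrite l0 mulr0 !scale0r !scaler0 oppr0 addr0.
  have -> : (l.-1%:R : R[i]) = l%:R - 1 by rewrite -subn1 natrB.
  rewrite (coefP_dZ pq (sc l) (wc l)).
  move: (dZ _ _ (coefP _ _ _ _)) (dZ _ _ (c l)) => u v.
  by apply/funext => g; rewrite !(cfunD, cfunN, cfunZ); field.
- rewrite /commutator (dolbeault_bar_spin pq _ _ sc) PE; last by move=> l; exact: smoothZ.
  rewrite PE// (dolbeault_bar_spin pq _ _ (fun l => sP _ l)) (opH_spin pq).
  rewrite (dolbeault_bar_spin pq _ _ (fun l => smoothZ _ (sc l))).
  rewrite !spinZ !spinN !spinD; apply: spin_eq => l; split; last by left.
  rewrite (coefP_scale _ _ _ _ (sb l)) (dZbar_scale _ sE sF (sc l)).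
  rewrite -[l.+1%:R]natr1 (coefP_dZbar pq (sc l) (wc l)).
  move: (dZbar _ _ (coefP _ _ _ _)) (dZbar _ _ (c l)) => u v.
  by apply/funext => g; rewrite !(cfunD, cfunN, cfunZ); field.
Qed.
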